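(* Let $0<p<2$, $q>0$, $M>0$ and $\alpha\le\frac{1}{2p}$ with $\alpha>0$ and $s=\alpha+\frac12-\frac1p>0$. In the Gaussian sequence model $Y_i=\theta_i+n^{-1/2}z_i$ ($z_i$ i.i.d. $N(0,1)$), let $m_3=n^{p/(1+2ps)}$, let $\tau_i=2\lceil\log_2(i/m_3)\rceil$ for $i>m_3$, let $\mu_{n,i}=E_0\{(Y_i^2-\tau_i/n)_+\}$ (expectation under $\theta=0$), let $J_*$ be the largest integer with $2^{J_*}m_3\le n^{1/(4s)}\log n$, and define $$\hat Q_3=\sum_{i=1}^{m_3}\Big(Y_i^2-\frac1n\Big)+\sum_{i=m_3+1}^{2^{J_*}m_3}\Big\{\Big(Y_i^2-\frac{\tau_i}{n}\Big)_+-\mu_{n,i}\Big\}.$$ Then there is a constant $C>0$ such that, for $\Theta=B^\alpha_{p,q}(M)$ and for $\Theta=L_p(\alpha,M)$, $$\sup_{\theta\in\Theta}E_\theta(\hat Q_3-Q(\theta))^2\le C\,n^{-(2-p/(1+2ps))}(1+o(1))\quad(n\to\infty),$$ where $Q(\theta)=\sum_i\theta_i^2$.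
   Context: $\lceil x\rceil$ is the smallest integer $\ge x$; $m_3$ is treated as an integer. The $L_p$ ball is $L_p(\alpha,M)=\{\theta:(\sum_{i\ge1}i^{ps}|\theta_i|^p)^{1/p}\le M\}$ with $s=\alpha+\frac12-\frac1p$. For Besov balls, sequences are doubly indexed $\theta_{j,k}$, $j=0,1,\dots$, $k=0,\dots,2^j-1$, identified with $\theta_i$ via $i=2^j+k$, and $B^\alpha_{p,q}(M)=\{\theta:(\sum_{j\ge0}(2^{js}(\sum_{k=0}^{2^j-1}|\theta_{j,k}|^p)^{1/p})^q)^{1/q}\le M\}$. *)

(* Defs.v *)
From Stdlib Require Import Reals Lra ZArith.
From Coquelicot Require Import Coquelicot.
Open Scope R_scope.

(* x^y for x >= 0, y > 0, with the convention 0^y = 0 (Stdlib's Rpower is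
   only meaningful for x > 0). *)
Definition rpow (x y : R) : R :=
  if Req_EM_T x 0 then 0 else Rpower x y.

Definition ceilZ (x : R) : Z := (- Int_part (- x))%Z.
Definition floorZ (x : R) : Z := Int_part x.

Definition log2 (x : R) : R := ln x / ln 2.

(* Sequences theta : nat -> R, theta i meaningful for i >= 1 (theta 0 unused). *)

Definition sparam (p alpha : R) : R := alpha + / 2 - / p.

Definition Lp_ball (p alpha M : R) (theta : nat -> R) : Prop :=
  let s := sparam p alpha in
  let a := fun k : nat => Rpower (INR (S k)) (p * s) * rpow (Rabs (theta (S k))) p in
  ex_series a /\ rpow (Series a) (/ p) <= M.

(* Besov ball: theta_{j,k} = theta (2^j + k), k = 0..2^j-1,
   (sum_{j>=0} (2^{js} (sum_k |theta_{j,k}|^p)^{1/p})^q)^{1/q} <= M *)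
Definition besov_ball (p q alpha M : R) (theta : nat -> R) : Prop :=
  let s := sparam p alpha in
  let b := fun j : nat =>
    rpow (Rpower 2 (INR j * s) *
          rpow (sum_n_m (fun k => rpow (Rabs (theta (2 ^ j + k)%nat)) p) 0 (2 ^ j - 1))
               (/ p)) q in
  ex_series b /\ rpow (Series b) (/ q) <= M.

Definition Qfun (theta : nat -> R) : R := Series (fun k => (theta (S k)) ^ 2).

Definition phi (x : R) : R := exp (- x ^ 2 / 2) / sqrt (2 * PI).

Definition Rint_line (f : R -> R) : R :=
  RInt_gen f (Rbar_locally m_infty) (Rbar_locally p_infty).

Definition upd (z : nat -> R) (i : nat) (x : R) : nat -> R :=
  fun j => if Nat.eqb j i then x else z j.

(* gexp k f = E f(z) where z_1, ..., z_k are i.i.d. N(0,1) (and the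
   other coordinates are set to 0): iterated integral against the product
   of standard normal densities. *)
Fixpoint gexp (k : nat) (f : (nat -> R) -> R) : R :=
  match k with
  | O => f (fun _ => 0)
  | S k' => Rint_line (fun x => phi x * gexp k' (fun z => f (upd z (S k') x)))
  end.

Definition m3 (p alpha : R) (n : nat) : nat :=
  Z.to_nat (floorZ (Rpower (INR n) (p / (1 + 2 * p * sparam p alpha)))).

Definition tau (p alpha : R) (n i : nat) : R :=
  2 * IZR (ceilZ (log2 (INR i / INR (m3 p alpha n)))).

Definition pos_part (x : R) : R := Rmax x 0.

(* mu_{n,i} = E_0 (Y_i^2 - tau_i/n)_+  where under theta = 0, Y_i = z_i / sqrt n *)
Definition mu (p alpha : R) (n i : nat) : R :=
  Rint_line (fun x => phi x *
    pos_part ((x / sqrt (INR n)) ^ 2 - tau p alpha n i / INR n)).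

Definition is_Jstar (p alpha : R) (n J : nat) : Prop :=
  let X := Rpower (INR n) (/ (4 * sparam p alpha)) * ln (INR n) in
  INR (2 ^ J * m3 p alpha n) <= X /\
  forall J' : nat, INR (2 ^ J' * m3 p alpha n) <= X -> (J' <= J)%nat.

Definition Qhat3 (p alpha : R) (n J : nat) (Y : nat -> R) : R :=
  let m := m3 p alpha n in
  sum_n_m (fun i => Y i ^ 2 - / INR n) 1 m +
  sum_n_m (fun i => pos_part (Y i ^ 2 - tau p alpha n i / INR n) - mu p alpha n i)
          (S m) (2 ^ J * m).

Definition risk3 (p alpha : R) (n J : nat) (theta : nat -> R) : R :=
  gexp (2 ^ J * m3 p alpha n)
    (fun z => (Qhat3 p alpha n J (fun i => theta i + z i / sqrt (INR n)) - Qfun theta) ^ 2).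

(* Main.v *)
(* The squared-bias/variance decomposition reduces the risk to one-dimensional Gaussian
   means.  With [h_t y = (y^2 - t)_+] and [a = sqrt n * theta_i], the bias of one
   thresholded term is [D/n] with [|D| <= min(t, C a^2)]: the bound by [t] holds since
   [h_t y - y^2] lies in [[-t, 0]], the bound by [a^2] by the change of measure
   [E h(a + z) = E h(z) exp(a z - a^2/2)], whose linear term vanishes by symmetry.
   Interpolating, [min(theta^2, t/n) <= |theta|^p (t/n)^(1 - p/2)], and both balls satisfy
   [sum_(i >= K) |theta_i|^p <= A K^(-ps)]; summing over the dyadic blocks
   [2^j m3 < i <= 2^(j+1) m3], on which [tau_i = 2(j+1)], gives total bias of order
   [n^(-(1 - r/2))] with [r = p/(1+2ps)].  The variances add up to order [m3/n^2 + 1/n],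
   and [alpha <= 1/(2p)] means [r >= 1], so that [1/n] is within the rate. *)
Require Import Defs.
From Stdlib Require Import Reals Lra Lia ZArith FunctionalExtensionality.
From Coquelicot Require Import Coquelicot.
Open Scope R_scope.

(** * Gaussian integral *)

(** Expectations are improper integrals given by a total function, so even their additivity needs
    existence first. Integrands are therefore kept in one class, [dominated]: continuous and at most
    a multiple of the envelope [exp (2/5 x^2)]. The envelope has the explicit mean [sqrt 5], from
    which both existence and the numerical constants follow. No product measure is built. The mean
    square of a constant plus one-coordinate terms is evaluated by peeling off one integral at a
    time, which yields squared mean plus sum of variances directly. The delicate estimate is the
    bias bound of order [a^2]: Lipschitz continuity of [h_t] alone gives order [|a|], which is too
    large for small [a], and this is what forces the change of measure. Stopping at [N = 2^J m3]
    leaves out a signal energy of order [N^(-2s)], hence of order [n^(-1/2)]; here again [r >= 1]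
    puts it within the rate. *)

Notation line_integral f l :=
  (is_RInt_gen f (Rbar_locally m_infty) (Rbar_locally p_infty) l).

Lemma filter_prod_infty (P : R * R -> Prop) (A : R) :
  (forall a b, a < - A -> A < b -> P (a, b)) ->
  filter_prod (Rbar_locally m_infty) (Rbar_locally p_infty) P.
Proof.
  intros H.
  apply (Filter_prod _ _ _ (fun a => a < - A) (fun b => A < b)).
  - exists (- A); auto.
  - exists A; auto.
  - exact H.
Qed.

Lemma filter_prod_infty_inv (P : R * R -> Prop) :
  filter_prod (Rbar_locally m_infty) (Rbar_locally p_infty) P ->
  exists A : R, forall a b, a < - A -> A < b -> P (a, b).
Proof.
  intros [Q R [A HA] [B HB] H].
  exists (Rmax (- A) B); intros a b Ha Hb.
  pose proof (Rmax_l (- A) B); pose proof (Rmax_r (- A) B).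
  apply H; [apply HA | apply HB]; lra.
Qed.

Lemma ex_RInt_continuous_all (f : R -> R) (a b : R) :
  (forall x, continuous f x) -> ex_RInt f a b.
Proof. intros H; apply (ex_RInt_continuous f); auto. Qed.

Lemma line_integral_derive (F f : R -> R) (la lb : R) :
  (forall x, is_derive F x (f x)) -> (forall x, continuous f x) ->
  is_lim F m_infty la -> is_lim F p_infty lb -> line_integral f (lb - la).
Proof.
  intros HF Hf Ha Hb.
  replace f with (Derive F)
    by (apply functional_extensionality; intros x; now apply is_derive_unique).
  apply is_RInt_gen_Derive; auto; apply (filter_prod_infty _ 0); intros a b _ _ x _; simpl.
  - eexists; apply HF.
  - apply continuous_ext with f; auto.
    intros y; symmetry; now apply is_derive_unique.
Qed.

(** Monotone convergence: the limit is the supremum of the integrals over [[-c, c]]. Nonnegativity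
    makes the integral grow with the interval, so one good [c] controls every interval containing
    [[-c, c]], however its two ends go to infinity. *)
Lemma ex_line_integral_bounded (f : R -> R) (B : R) :
  (forall x, continuous f x) -> (forall x, 0 <= f x) ->
  (forall a b, a <= b -> RInt f a b <= B) ->
  exists l, line_integral f l.
Proof.
  intros Hc H0 HB.
  set (E := fun y => exists c, 0 <= c /\ y = RInt f (- c) c).
  destruct (completeness E) as [l [Hub Hlub]].
  { exists B; intros y [c [Hc0 ->]]; apply HB; lra. }
  { exists (RInt f (- 0) 0), 0; split; auto; lra. }
  exists l.
  assert (Hmono : forall a b c d, a <= b -> b <= c -> c <= d -> RInt f b c <= RInt f a d).
  { intros a b c d Hab Hbc Hcd.
    rewrite <- (RInt_Chasles f a b d), <- (RInt_Chasles f b c d)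
      by (apply ex_RInt_continuous_all; auto).
    assert (0 <= RInt f a b)
      by (apply RInt_ge_0; auto; apply ex_RInt_continuous_all; auto).
    assert (0 <= RInt f c d)
      by (apply RInt_ge_0; auto; apply ex_RInt_continuous_all; auto).
    unfold plus; simpl; lra. }
  assert (Hle : forall a b, a <= b -> RInt f a b <= l).
  { intros a b Hab.
    set (c := Rmax (Rabs a) (Rabs b)).
    assert (Hca := Rmax_l (Rabs a) (Rabs b)); assert (Hcb := Rmax_r (Rabs a) (Rabs b)).
    fold c in Hca, Hcb.
    assert (H1 := Rabs_pos a); assert (H2 := Rle_abs b); assert (H3 := Rle_abs (- a)).
    rewrite Rabs_Ropp in H3.
    apply Rle_trans with (RInt f (- c) c).
    - apply Hmono; lra.
    - apply Hub; exists c; split; auto; lra. }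
  intros P [eps HP].
  assert (Hex : exists c, 0 <= c /\ l - eps < RInt f (- c) c).
  { apply Classical_Prop.NNPP; intros Hn.
    assert (l <= l - eps).
    { apply Hlub; intros y [c [Hc0 ->]].
      apply Rnot_lt_le; intros Hlt; apply Hn; exists c; auto. }
    pose proof (cond_pos eps); lra. }
  destruct Hex as [c [Hc0 Hlt]].
  unfold filtermapi.
  apply (filter_prod_infty _ c); intros a b Ha Hb; simpl.
  exists (RInt f a b); split.
  - apply (RInt_correct f), ex_RInt_continuous_all; auto.
  - apply HP; unfold ball; simpl; unfold AbsRing_ball, abs, minus, plus, opp; simpl.
    assert (RInt f (- c) c <= RInt f a b) by (apply Hmono; lra).
    assert (RInt f a b <= l) by (apply Hle; lra).
    apply Rabs_def1; pose proof (cond_pos eps); lra.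
Qed.

(** Positivity is read off the norm inequality for improper integrals, applied to the zero function
    dominated by [f]. *)
Lemma line_integral_ge_0 (f : R -> R) (l : R) :
  (forall x, 0 <= f x) -> line_integral f l -> 0 <= l.
Proof.
  intros Hf Hl.
  assert (H0 : line_integral (fun _ : R => 0) (0 - 0)).
  { apply (line_integral_derive (fun _ => 0)); intros.
    - apply (is_derive_const 0).
    - apply continuous_const.
    - apply is_lim_const.
    - apply is_lim_const. }
  rewrite Rminus_0_r in H0.
  assert (H : norm 0 <= l).
  { eapply (RInt_gen_norm (fun _ : R => 0) f); [ | | exact H0 | exact Hl].
    - apply (filter_prod_infty _ 0); intros; simpl; lra.
    - apply (filter_prod_infty _ 0); intros; simpl.
      unfold norm; simpl; unfold abs; simpl; rewrite Rabs_R0; auto. }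
  unfold norm in H; simpl in H; unfold abs in H; simpl in H; now rewrite Rabs_R0 in H.
Qed.

(** Translations serve the change of measure, the reflection serves the vanishing of odd means. *)
Lemma line_integral_comp_affine (f : R -> R) (u v l : R) :
  u = 1 \/ u = - 1 -> line_integral f l -> line_integral (fun x => f (u * x + v)) l.
Proof.
  intros Hu Hl P HP.
  destruct (filter_prod_infty_inv _ (Hl P HP)) as [A HA].
  unfold filtermapi.
  apply (filter_prod_infty _ (A + Rabs v)); intros a b Ha Hb; simpl in *.
  assert (Hv1 := Rle_abs v); assert (Hv2 := Rle_abs (- v)); rewrite Rabs_Ropp in Hv2.
  destruct Hu as [-> | ->].
  - destruct (HA (1 * a + v) (1 * b + v)) as [y [Hy Py]]; try lra.
    exists y; split; auto.
    refine (is_RInt_ext _ _ _ _ _ _ (is_RInt_comp_lin f 1 v a b y Hy)).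
    intros x _; unfold scal; simpl; unfold mult; simpl; ring.
  (* The reflection exchanges the two ends; swapping the bounds back costs a sign, which cancels the
     factor [-1] of the substitution. *)
  - destruct (HA (- 1 * b + v) (- 1 * a + v)) as [y [Hy Py]]; try lra.
    exists y; split; auto.
    pose proof (is_RInt_opp _ _ _ _ (is_RInt_comp_lin f (- 1) v a b _ (is_RInt_swap _ _ _ _ Hy)))
      as H.
    rewrite opp_opp in H.
    refine (is_RInt_ext _ _ _ _ _ _ H).
    intros x _; unfold opp, scal; simpl; unfold mult; simpl; ring.
Qed.

(* Laplace's trick: [(int_0^t exp(-x^2/2))^2 + gauss_aux t] has zero derivative. *)
Definition gauss_aux (t : R) : R :=
  RInt (fun x => 2 / (1 + x ^ 2) * exp (- (t ^ 2 * (1 + x ^ 2) / 2))) 0 1.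

Definition gauss_int (t : R) : R := RInt (fun x => exp (- x ^ 2 / 2)) 0 t.

Lemma continuous_gauss x : continuous (fun x => exp (- x ^ 2 / 2)) x.
Proof.
  apply (ex_derive_continuous (fun x => exp (- x ^ 2 / 2))); auto_derive; auto.
Qed.

Lemma is_derive_gauss_int t : is_derive gauss_int t (exp (- t ^ 2 / 2)).
Proof.
  apply (is_derive_RInt (fun x => exp (- x ^ 2 / 2)) gauss_int 0).
  - apply filter_forall; intros y.
    apply (RInt_correct (fun x => exp (- x ^ 2 / 2))), ex_RInt_continuous_all, continuous_gauss.
  - apply continuous_gauss.
Qed.

Lemma one_plus_sqr_pos x : 0 < 1 + x ^ 2.
Proof. pose proof (pow2_ge_0 x); lra. Qed.

(** The fixed interval [[0, 1]] is the one over which [gauss_aux] integrates, so the derivative of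
    [gauss_aux] can be recognised in this form. *)
Lemma gauss_int_comp t :
  RInt (fun x => t * exp (- (t * x) ^ 2 / 2)) 0 1 = gauss_int t.
Proof.
  unfold gauss_int.
  transitivity (RInt (fun x => exp (- x ^ 2 / 2)) (t * 0 + 0) (t * 1 + 0)).
  2: f_equal; ring.
  rewrite <- (RInt_comp_lin (fun x => exp (- x ^ 2 / 2)) t 0 0 1)
    by (apply ex_RInt_continuous_all, continuous_gauss).
  apply RInt_ext; intros x _; unfold scal; simpl; unfold mult; simpl.
  now rewrite Rplus_0_r.
Qed.

(** Differentiation under the integral sign: the factor [1 + x ^ 2] coming down from the exponent
    cancels the denominator, and the exponential splits into [exp (- t^2/2)] times the integrand of
    [gauss_int_comp]. The result is minus the derivative of [gauss_int t ^ 2]. *)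
Lemma is_derive_gauss_aux t :
  is_derive gauss_aux t (- 2 * exp (- t ^ 2 / 2) * gauss_int t).
Proof.
  set (f := fun t x : R => 2 / (1 + x ^ 2) * exp (- (t ^ 2 * (1 + x ^ 2) / 2))).
  assert (Hd : forall u x : R, is_derive (fun z => f z x) u
     (- 2 * exp (- u ^ 2 / 2) * (u * exp (- (u * x) ^ 2 / 2)))).
  { intros u x; unfold f; pose proof (one_plus_sqr_pos x).
    assert (He : exp (- u ^ 2 / 2) * exp (- (u * x) ^ 2 / 2)
                 = exp (- (u ^ 2 * (1 + x ^ 2) / 2)))
      by (rewrite <- exp_plus; f_equal; field).
    evar_last.
    - apply (is_derive_scal (fun z => exp (- (z ^ 2 * (1 + x ^ 2) / 2))) u (2 / (1 + x ^ 2))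
        (- (u * (1 + x ^ 2)) * exp (- (u ^ 2 * (1 + x ^ 2) / 2)))).
      auto_derive; auto; simpl; unfold Rdiv; field.
    - rewrite <- He; field; lra. }
  assert (HD : (fun u v => Derive (fun z => f z v) u) =
    (fun u v => - 2 * exp (- u ^ 2 / 2) * (u * exp (- (u * v) ^ 2 / 2)))).
  { apply functional_extensionality; intros u; apply functional_extensionality; intros v.
    apply is_derive_unique, Hd. }
  evar_last.
  - apply (is_derive_RInt_param f 0 1 t).
    + apply filter_forall; intros u x _; eexists; apply Hd.
    + intros x _; rewrite HD.
      assert (He : forall y, continuity_pt exp y)
        by (intros y; apply derivable_continuous_pt, derivable_pt_exp).
      repeat first
        [ apply continuity_2d_pt_mult | apply continuity_2d_pt_const
        | apply continuity_2d_pt_opp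
        | apply continuity_2d_pt_id1 | apply continuity_2d_pt_id2
        | apply (continuity_1d_2d_pt_comp exp); [apply He |] ].
    + apply filter_forall; intros u; apply ex_RInt_continuous_all; intros x.
      apply (ex_derive_continuous (f u)); unfold f; auto_derive.
      pose proof (one_plus_sqr_pos x); simpl in *; lra.
  - rewrite <- gauss_int_comp.
    transitivity (RInt (fun x => scal (- 2 * exp (- t ^ 2 / 2))
                            (t * exp (- (t * x) ^ 2 / 2))) 0 1).
    + apply RInt_ext; intros x _.
      apply (f_equal (fun F => F t x)) in HD; exact HD.
    + apply (RInt_scal (fun x => t * exp (- (t * x) ^ 2 / 2)) 0 1 (- 2 * exp (- t ^ 2 / 2))).
      apply ex_RInt_continuous_all; intros x.
      apply (ex_derive_continuous (fun x => t * exp (- (t * x) ^ 2 / 2))); auto_derive; auto.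
Qed.

Lemma gauss_aux_0 : gauss_aux 0 = PI / 2.
Proof.
  unfold gauss_aux; apply is_RInt_unique.
  replace (PI / 2) with (minus (2 * atan 1) (2 * atan 0)).
  2: { rewrite atan_1, atan_0; unfold minus, plus, opp; simpl; lra. }
  apply (is_RInt_derive (fun x => 2 * atan x)); intros x _; pose proof (one_plus_sqr_pos x).
  - evar_last.
    + apply is_derive_scal, is_derive_atan.
    + replace (- (0 ^ 2 * (1 + x ^ 2) / 2)) with 0 by field.
      rewrite exp_0; unfold Rsqr; simpl; field; simpl in *; lra.
  - apply (ex_derive_continuous
      (fun x => 2 / (1 + x ^ 2) * exp (- (0 ^ 2 * (1 + x ^ 2) / 2)))).
    auto_derive; simpl in *; lra.
Qed.

Lemma gauss_int_sqr t : gauss_int t ^ 2 + gauss_aux t = PI / 2.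
Proof.
  set (F := fun t => gauss_int t ^ 2 + gauss_aux t).
  assert (HF : forall t, is_derive F t 0).
  { intros u; unfold F; evar_last.
    - apply (is_derive_plus (fun t => gauss_int t ^ 2)).
      + apply is_derive_pow, is_derive_gauss_int.
      + apply is_derive_gauss_aux.
    - unfold plus; simpl; ring. }
  assert (H0 : F 0 = PI / 2).
  { unfold F, gauss_int; rewrite RInt_point, gauss_aux_0; unfold zero; simpl; ring. }
  fold (F t); rewrite <- H0.
  destruct (MVT_gen F 0 t (fun _ => 0)) as [c [_ Hc]].
  - intros; apply HF.
  - intros x _; apply continuity_pt_filterlim, (ex_derive_continuous F); eexists; apply HF.
  - lra.
Qed.

Lemma exp_le_exp x y : x <= y -> exp x <= exp y.
Proof.
  intros [H | ->]; [left; now apply exp_increasing | right; reflexivity].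
Qed.

Lemma exp_neg_sqr_le t : exp (- t ^ 2 / 2) <= 2 / (2 + t ^ 2).
Proof.
  replace (- t ^ 2 / 2) with (- (t ^ 2 / 2)) by field.
  rewrite exp_Ropp.
  pose proof (pow2_ge_0 t).
  pose proof (exp_ineq1_le (t ^ 2 / 2)).
  replace (2 / (2 + t ^ 2)) with (/ (1 + t ^ 2 / 2)) by (field; lra).
  apply Rinv_le_contravar; lra.
Qed.

Lemma gauss_aux_bound t : 0 <= gauss_aux t <= 4 / (2 + t ^ 2).
Proof.
  assert (He : ex_RInt (fun x => 2 / (1 + x ^ 2) * exp (- (t ^ 2 * (1 + x ^ 2) / 2))) 0 1).
  { apply ex_RInt_continuous_all; intros x.
    apply (ex_derive_continuous
      (fun x => 2 / (1 + x ^ 2) * exp (- (t ^ 2 * (1 + x ^ 2) / 2)))).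
    pose proof (one_plus_sqr_pos x); auto_derive; simpl in *; lra. }
  assert (Hi : forall x, 0 < / (1 + x ^ 2) <= 1).
  { intros x; pose proof (one_plus_sqr_pos x); pose proof (pow2_ge_0 x); split.
    - now apply Rinv_0_lt_compat.
    - rewrite <- Rinv_1; apply Rinv_le_contravar; lra. }
  split.
  - apply RInt_ge_0; [lra | exact He |].
    intros x _; apply Rmult_le_pos; [destruct (Hi x); unfold Rdiv; lra | left; apply exp_pos].
  - replace (4 / (2 + t ^ 2)) with (RInt (fun _ => 4 / (2 + t ^ 2)) 0 1).
    2: { rewrite RInt_const; unfold scal; simpl; unfold mult; simpl; ring. }
    apply RInt_le; [lra | exact He | apply ex_RInt_const |].
    intros x _; pose proof (Hi x); pose proof (exp_neg_sqr_le t).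
    assert (exp (- (t ^ 2 * (1 + x ^ 2) / 2)) <= exp (- t ^ 2 / 2)).
    { apply exp_le_exp; pose proof (pow2_ge_0 t); pose proof (pow2_ge_0 x); nra. }
    pose proof (exp_pos (- (t ^ 2 * (1 + x ^ 2) / 2))).
    apply Rle_trans with (2 * (2 / (2 + t ^ 2))); [| right; field; pose proof (pow2_ge_0 t); lra].
    apply Rmult_le_compat; unfold Rdiv in *; lra.
Qed.

Lemma gauss_int_opp t : gauss_int (- t) = - gauss_int t.
Proof.
  unfold gauss_int; apply is_RInt_unique.
  assert (H : is_RInt (fun x => exp (- x ^ 2 / 2)) (- 1 * 0 + 0) (- 1 * - t + 0)
                (gauss_int t)).
  { replace (- 1 * 0 + 0) with 0 by ring; replace (- 1 * - t + 0) with t by ring.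
    apply (RInt_correct (fun x => exp (- x ^ 2 / 2))), ex_RInt_continuous_all, continuous_gauss. }
  refine (is_RInt_ext _ _ _ _ _ _ (is_RInt_opp _ _ _ _ (is_RInt_comp_lin _ _ _ _ _ _ H))).
  intros x _; unfold opp, scal; simpl; unfold mult; simpl.
  replace (- 1 * x + 0) with (- x) by ring.
  replace (- x * (- x * 1)) with (x * (x * 1)) by ring; ring.
Qed.

Lemma is_lim_inv_sqr : is_lim (fun t => 4 / (2 + t ^ 2)) p_infty 0.
Proof.
  intros P [eps HP].
  exists (4 / eps + 1); intros x Hx; apply HP.
  pose proof (cond_pos eps).
  assert (0 < 4 / eps) by (apply Rdiv_lt_0_compat; lra).
  unfold ball; simpl; unfold AbsRing_ball, abs, minus, plus, opp; simpl.
  assert (0 < 4 / (2 + x * (x * 1))) by (apply Rdiv_lt_0_compat; nra).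
  rewrite Rabs_pos_eq by lra.
  replace (4 / (2 + x * (x * 1)) + - 0) with (4 / (2 + x * (x * 1))) by ring.
  apply Rmult_lt_reg_r with (2 + x * (x * 1)); [nra |].
  replace (4 / (2 + x * (x * 1)) * (2 + x * (x * 1))) with (4 / eps * eps) by (field; split; nra).
  rewrite (Rmult_comm eps); apply Rmult_lt_compat_r; nra.
Qed.

Lemma is_lim_gauss_int : is_lim gauss_int p_infty (sqrt (PI / 2)).
Proof.
  apply (is_lim_ext_loc (fun t => sqrt (PI / 2 - gauss_aux t))).
  { exists 0; intros t Ht.
    pose proof (gauss_int_sqr t).
    replace (PI / 2 - gauss_aux t) with (gauss_int t ^ 2) by lra.
    apply sqrt_pow2; unfold gauss_int; apply RInt_ge_0; [lra | | intros; left; apply exp_pos].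
    apply ex_RInt_continuous_all, continuous_gauss. }
  assert (H : is_lim (fun t => PI / 2 - gauss_aux t) p_infty (PI / 2 - 0)).
  { apply (is_lim_minus' (fun _ => PI / 2) gauss_aux).
    - apply is_lim_const.
    - apply (is_lim_le_le_loc (fun _ => 0) (fun t => 4 / (2 + t ^ 2))).
      + exists 0; intros; apply gauss_aux_bound.
      + apply is_lim_const.
      + apply is_lim_inv_sqr. }
  rewrite Rminus_0_r in H.
  apply (is_lim_comp_continuous (fun t => PI / 2 - gauss_aux t) sqrt); auto.
  apply continuous_sqrt.
Qed.

(** * Gaussian means *)

Lemma sqrt_2PI_ge_1 : 1 <= sqrt (2 * PI).
Proof.
  rewrite <- sqrt_1 at 1; apply sqrt_le_1_alt; pose proof PI2_1; lra.
Qed.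

Lemma phi_pos x : 0 < phi x.
Proof.
  unfold phi; pose proof sqrt_2PI_ge_1; apply Rdiv_lt_0_compat; [apply exp_pos | lra].
Qed.

Lemma continuous_phi x : continuous phi x.
Proof.
  apply (ex_derive_continuous phi); unfold phi.
  pose proof sqrt_2PI_ge_1; auto_derive; lra.
Qed.

(** The normal distribution function minus [1/2]. Centred this way it is odd, so its limit at minus
    infinity follows from the one at plus infinity. *)
Definition gauss_cdf (t : R) : R := gauss_int t / sqrt (2 * PI).

Lemma is_derive_gauss_cdf t : is_derive gauss_cdf t (phi t).
Proof.
  apply (is_derive_ext (fun t => / sqrt (2 * PI) * gauss_int t)).
  { intros u; unfold gauss_cdf; apply Rmult_comm. }
  evar_last.
  - apply is_derive_scal, is_derive_gauss_int.
  - unfold phi; apply Rmult_comm.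
Qed.

Lemma is_lim_gauss_cdf_p : is_lim gauss_cdf p_infty (/ 2).
Proof.
  assert (H : is_lim gauss_cdf p_infty (/ sqrt (2 * PI) * sqrt (PI / 2))).
  { apply (is_lim_ext (fun t => / sqrt (2 * PI) * gauss_int t)).
    { intros u; unfold gauss_cdf; apply Rmult_comm. }
    apply (is_lim_scal_l gauss_int _ p_infty (sqrt (PI / 2))), is_lim_gauss_int. }
  replace (/ 2) with (/ sqrt (2 * PI) * sqrt (PI / 2)); auto.
  pose proof PI2_1.
  assert (0 < sqrt (PI / 2)) by (apply sqrt_lt_R0; lra).
  replace (2 * PI) with (2 ^ 2 * (PI / 2)) by field.
  rewrite sqrt_mult, sqrt_pow2 by lra.
  field; lra.
Qed.

Lemma is_lim_odd (F : R -> R) (l : R) :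
  (forall x, F (- x) = - F x) -> is_lim F p_infty l -> is_lim F m_infty (- l).
Proof.
  intros Ho Hl.
  apply (is_lim_ext (fun x => - F (- x))).
  { intros x; rewrite Ho; ring. }
  apply (is_lim_opp (fun x => F (- x)) m_infty l).
  apply (is_lim_comp F (fun x => - x) m_infty l p_infty); auto.
  - apply (is_lim_opp (fun x => x) m_infty m_infty), is_lim_id.
  - exists 0; intros; discriminate.
Qed.

Lemma gauss_cdf_opp t : gauss_cdf (- t) = - gauss_cdf t.
Proof. unfold gauss_cdf; rewrite gauss_int_opp; unfold Rdiv; ring. Qed.

Lemma is_lim_x_phi : is_lim (fun x => x * phi x) p_infty 0.
Proof.
  intros P [eps HP].
  pose proof (cond_pos eps).
  assert (0 < 2 / eps) by (apply Rdiv_lt_0_compat; lra).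
  exists (2 / eps); intros x Hx; apply HP.
  unfold ball; simpl; unfold AbsRing_ball, abs, minus, plus, opp; simpl.
  pose proof (phi_pos x).
  assert (phi x <= 2 / (2 + x ^ 2)).
  { apply Rle_trans with (exp (- x ^ 2 / 2)); [| apply exp_neg_sqr_le].
    unfold phi, Rdiv at 1; rewrite <- (Rmult_1_r (exp (- x ^ 2 / 2))) at 2.
    apply Rmult_le_compat_l; [left; apply exp_pos |].
    rewrite <- Rinv_1; pose proof sqrt_2PI_ge_1; apply Rinv_le_contravar; lra. }
  assert (x * phi x <= x * (2 / (2 + x ^ 2))) by (apply Rmult_le_compat_l; lra).
  assert (x * (2 / (2 + x ^ 2)) < eps).
  { apply Rmult_lt_reg_r with (2 + x ^ 2); [simpl; nra |].
    replace (x * (2 / (2 + x ^ 2)) * (2 + x ^ 2)) with (x * (2 / eps * eps))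
      by (field; simpl; split; nra).
    apply Rlt_trans with (x * (x * eps)).
    - apply Rmult_lt_compat_l; [lra |]; apply Rmult_lt_compat_r; lra.
    - simpl; nra. }
  rewrite Rabs_pos_eq; [lra |].
  assert (0 <= x * phi x) by (apply Rmult_le_pos; lra); lra.
Qed.

Lemma phi_opp x : phi (- x) = phi x.
Proof. unfold phi; do 2 f_equal; field. Qed.

(** The relation carries the existence of the integral, whereas [Gmean] is the total function to
    which [mu] and each layer of [gexp] unfold; [gauss_mean_unique] and [Gmean_correct] pass between
    the two. *)
Definition gauss_mean (f : R -> R) (l : R) : Prop := line_integral (fun x => phi x * f x) l.

Definition Gmean (f : R -> R) : R := Rint_line (fun x => phi x * f x).

Lemma gauss_mean_unique f l : gauss_mean f l -> Gmean f = l.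
Proof. apply (is_RInt_gen_unique (fun x => phi x * f x)). Qed.

Lemma gauss_mean_1 : gauss_mean (fun _ => 1) 1.
Proof.
  assert (H : line_integral (fun x => phi x * 1) (/ 2 - - / 2)).
  { apply (line_integral_derive gauss_cdf).
    - intros x; rewrite Rmult_1_r; apply is_derive_gauss_cdf.
    - intros x; apply (continuous_ext phi); [intros; symmetry; apply Rmult_1_r | apply continuous_phi].
    - apply (is_lim_odd _ (/ 2)); [apply gauss_cdf_opp | apply is_lim_gauss_cdf_p].
    - apply is_lim_gauss_cdf_p. }
  replace (/ 2 - - / 2) with 1 in H by field; exact H.
Qed.

(** Integration by parts: since [phi' = - x phi], the function [gauss_cdf x - x * phi x] is a
    primitive of the integrand, and [x * phi x] vanishes at infinity. *)
Lemma gauss_mean_sqr : gauss_mean (fun x => x ^ 2) 1.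
Proof.
  set (F := fun x => gauss_cdf x - x * phi x).
  assert (Hp : is_lim F p_infty (/ 2 - 0))
    by (apply (is_lim_minus' gauss_cdf); [apply is_lim_gauss_cdf_p | apply is_lim_x_phi]).
  assert (H : line_integral (fun x => phi x * x ^ 2) (/ 2 - 0 - - (/ 2 - 0))).
  { apply (line_integral_derive F).
    - intros x; unfold F.
      assert (Hd : is_derive phi x (- x * phi x)).
      { unfold phi; pose proof sqrt_2PI_ge_1.
        auto_derive; [lra |]; simpl; unfold Rdiv; field; lra. }
      assert (Hx : is_derive (fun x => x * phi x) x (phi x - x * x * phi x)).
      { auto_derive; [eexists; apply Hd |].
        rewrite (is_derive_unique (fun y : R => phi y) x _ Hd); simpl; ring. }
      evar_last.
      + apply (is_derive_minus gauss_cdf (fun x => x * phi x));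
          [apply is_derive_gauss_cdf | apply Hx].
      + unfold minus, plus, opp; simpl; ring.
    - intros x; apply (continuous_mult phi (fun x => x ^ 2)); [apply continuous_phi |].
      apply (ex_derive_continuous (fun x => x ^ 2)); auto_derive; auto.
    - apply is_lim_odd; auto.
      intros x; unfold F; rewrite gauss_cdf_opp, phi_opp; ring.
    - exact Hp. }
  replace (/ 2 - 0 - - (/ 2 - 0)) with 1 in H by field; exact H.
Qed.

(** Because [1/2 - 2/5 = 1/10], the tilted density is [sqrt 5] times the normal density of variance
    [5]; this is where the mean [sqrt 5] of the envelope comes from. *)
Lemma phi_mul_exp x :
  phi x * exp (2 / 5 * x ^ 2) = phi (/ sqrt 5 * x).
Proof.
  assert (H5 : sqrt 5 ^ 2 = 5) by (apply pow2_sqrt; lra).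
  assert (0 < sqrt 5) by (apply sqrt_lt_R0; lra).
  unfold phi, Rdiv; rewrite Rmult_assoc, (Rmult_comm (/ sqrt _)), <- Rmult_assoc.
  f_equal; rewrite <- exp_plus; f_equal.
  rewrite Rpow_mult_distr, pow_inv, H5; field.
Qed.

Lemma is_derive_scaled_cdf x :
  is_derive (fun x => sqrt 5 * gauss_cdf (/ sqrt 5 * x)) x (phi x * exp (2 / 5 * x ^ 2)).
Proof.
  rewrite phi_mul_exp.
  assert (0 < sqrt 5) by (apply sqrt_lt_R0; lra).
  evar_last.
  - apply is_derive_scal.
    apply (is_derive_comp gauss_cdf (fun x => / sqrt 5 * x)).
    + apply is_derive_gauss_cdf.
    + apply (is_derive_scal (fun x => x)), is_derive_id.
  - unfold scal, one; simpl; unfold mult; simpl; field; lra.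
Qed.

Lemma continuous_phi_mul (f : R -> R) x :
  continuous f x -> continuous (fun x => phi x * f x) x.
Proof. intros H; apply (continuous_mult phi f); auto; apply continuous_phi. Qed.

Lemma continuous_exp_sqr c x : continuous (fun x => exp (c * x ^ 2)) x.
Proof. apply (ex_derive_continuous (fun x => exp (c * x ^ 2))); auto_derive; auto. Qed.

Lemma gauss_mean_exp_sqr : gauss_mean (fun x => exp (2 / 5 * x ^ 2)) (sqrt 5).
Proof.
  set (F := fun x => sqrt 5 * gauss_cdf (/ sqrt 5 * x)).
  assert (0 < sqrt 5) by (apply sqrt_lt_R0; lra).
  assert (0 < / sqrt 5) by (now apply Rinv_0_lt_compat).
  assert (Hp : is_lim F p_infty (sqrt 5 * / 2)).
  { apply (is_lim_scal_l (fun x => gauss_cdf (/ sqrt 5 * x)) (sqrt 5) p_infty (/ 2)).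
    apply (is_lim_comp gauss_cdf (fun x => / sqrt 5 * x) p_infty (/ 2) p_infty).
    - apply is_lim_gauss_cdf_p.
    - evar_last; [apply is_lim_scal_l, is_lim_id |].
      simpl; destruct Rle_dec; [| exfalso; lra]; destruct Rle_lt_or_eq_dec; auto; exfalso; lra.
    - exists 0; intros; discriminate. }
  assert (H5 : line_integral (fun x => phi x * exp (2 / 5 * x ^ 2))
    (sqrt 5 * / 2 - - (sqrt 5 * / 2))).
  { apply (line_integral_derive F).
    - apply is_derive_scaled_cdf.
    - intros x; apply continuous_phi_mul, continuous_exp_sqr.
    - apply is_lim_odd; auto.
      intros x; unfold F.
      replace (/ sqrt 5 * - x) with (- (/ sqrt 5 * x)) by ring.
      rewrite gauss_cdf_opp; ring.
    - exact Hp. }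
  replace (sqrt 5 * / 2 - - (sqrt 5 * / 2)) with (sqrt 5) in H5 by field; exact H5.
Qed.

Lemma gauss_cdf_bound t : Rabs (gauss_cdf t) <= 2.
Proof.
  assert (Rabs (gauss_int t) <= 2).
  { pose proof (gauss_int_sqr t); pose proof (gauss_aux_bound t); pose proof PI_4.
    apply Rabs_le; split; nra. }
  unfold gauss_cdf, Rdiv; rewrite Rabs_mult.
  pose proof sqrt_2PI_ge_1.
  assert (0 < / sqrt (2 * PI)) by (apply Rinv_0_lt_compat; lra).
  assert (/ sqrt (2 * PI) <= 1) by (rewrite <- Rinv_1; apply Rinv_le_contravar; lra).
  rewrite (Rabs_pos_eq (/ _)) by lra.
  pose proof (Rabs_pos (gauss_int t)); nra.
Qed.

Lemma RInt_phi_exp_sqr_bound a b :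
  RInt (fun x => phi x * exp (2 / 5 * x ^ 2)) a b <= sqrt 5 * 4.
Proof.
  rewrite (is_RInt_unique _ a b
    (minus (sqrt 5 * gauss_cdf (/ sqrt 5 * b)) (sqrt 5 * gauss_cdf (/ sqrt 5 * a)))).
  - unfold minus, plus, opp; simpl.
    pose proof (sqrt_pos 5).
    pose proof (gauss_cdf_bound (/ sqrt 5 * b)) as Hb.
    pose proof (gauss_cdf_bound (/ sqrt 5 * a)) as Ha.
    apply Rabs_le_between in Ha, Hb; nra.
  - apply (is_RInt_derive (fun x => sqrt 5 * gauss_cdf (/ sqrt 5 * x)));
      intros x _; [apply is_derive_scaled_cdf | apply continuous_phi_mul, continuous_exp_sqr].
Qed.

(* The rate 2/5 < 1/2 keeps [exp (2/5 x^2)] integrable against [phi], while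
   [2 * exp (- 4/5) < 1] makes the noise of the dyadic blocks summable. *)
Definition dominated (f : R -> R) : Prop :=
  (forall x, continuous f x) /\ exists K, forall x, Rabs (f x) <= K * exp (2 / 5 * x ^ 2).

Lemma gauss_mean_plus f g l l' :
  gauss_mean f l -> gauss_mean g l' -> gauss_mean (fun x => f x + g x) (l + l').
Proof.
  intros Hf Hg.
  refine (is_RInt_gen_ext _ _ _ _ (is_RInt_gen_plus _ _ _ _ Hf Hg)).
  apply (filter_prod_infty _ 0); intros a b _ _ x _; unfold plus; simpl; ring.
Qed.

Lemma gauss_mean_scal f c l : gauss_mean f l -> gauss_mean (fun x => c * f x) (c * l).
Proof.
  intros Hf.
  refine (is_RInt_gen_ext _ _ _ _ (is_RInt_gen_scal _ c _ Hf)).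
  apply (filter_prod_infty _ 0); intros a b _ _ x _.
  unfold scal; simpl; unfold mult; simpl; ring.
Qed.

Lemma gauss_mean_ge_0 f l : (forall x, 0 <= f x) -> gauss_mean f l -> 0 <= l.
Proof.
  intros H; apply line_integral_ge_0; intros x.
  apply Rmult_le_pos; [left; apply phi_pos | auto].
Qed.

Lemma dominated_plus f g : dominated f -> dominated g -> dominated (fun x => f x + g x).
Proof.
  intros [Cf [K HK]] [Cg [K' HK']]; split.
  - intros x; apply (continuous_plus f g); auto.
  - exists (K + K'); intros x; eapply Rle_trans; [apply Rabs_triang |].
    rewrite Rmult_plus_distr_r; apply Rplus_le_compat; auto.
Qed.

Lemma dominated_scal f c : dominated f -> dominated (fun x => c * f x).
Proof.
  intros [Cf [K HK]]; split.
  - intros x; apply (continuous_scal_r c f); auto.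
  - exists (Rabs c * K); intros x; rewrite Rabs_mult, Rmult_assoc.
    apply Rmult_le_compat_l; auto; apply Rabs_pos.
Qed.

Lemma exp_ge_1 x : 0 <= x -> 1 <= exp x.
Proof. intros H; pose proof (exp_ineq1_le x); lra. Qed.

Lemma sqr_le_exp v : 0 <= v -> v ^ 2 <= exp (2 * v).
Proof.
  intros H; replace (2 * v) with (v + v) by ring; rewrite exp_plus.
  pose proof (exp_ineq1_le v); nra.
Qed.

Lemma pow4_le_exp x : x ^ 4 <= 25 * exp (2 / 5 * x ^ 2).
Proof.
  (* With [v = x^2/5] the bound [v^2 <= exp (2 v)] has exactly the exponent of the envelope, and
     [25] undoes the scaling. *)
  pose proof (sqr_le_exp (x ^ 2 / 5)).
  replace (2 * (x ^ 2 / 5)) with (2 / 5 * x ^ 2) in H by field.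
  pose proof (pow2_ge_0 x).
  replace (x ^ 4) with (25 * (x ^ 2 / 5) ^ 2) by field.
  apply Rmult_le_compat_l; [lra | apply H; lra].
Qed.

Lemma dominated_quartic f A B :
  (forall x, continuous f x) -> 0 <= A -> 0 <= B ->
  (forall x, Rabs (f x) <= A + B * x ^ 4) -> dominated f.
Proof.
  intros Cf HA HB H; split; auto.
  exists (A + 25 * B); intros x; eapply Rle_trans; [apply H |].
  rewrite Rmult_plus_distr_r; apply Rplus_le_compat.
  - rewrite <- (Rmult_1_r A) at 1; apply Rmult_le_compat_l; auto.
    apply exp_ge_1; pose proof (pow2_ge_0 x); lra.
  - rewrite (Rmult_comm 25), Rmult_assoc; apply Rmult_le_compat_l; auto.
    apply pow4_le_exp.
Qed.

Lemma dominated_const c : dominated (fun _ => c).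
Proof.
  apply (dominated_quartic _ (Rabs c) 0); try lra.
  - intros; apply continuous_const.
  - apply Rabs_pos.
  - intros; lra.
Qed.

Lemma continuous_pow_n n x : continuous (fun x => x ^ n) x.
Proof. apply (ex_derive_continuous (fun x => x ^ n)); auto_derive; auto. Qed.

Lemma dominated_pow n : (n <= 4)%nat -> dominated (fun x => x ^ n).
Proof.
  intros Hn; apply (dominated_quartic _ 1 1); try lra.
  - apply continuous_pow_n.
  - intros x; rewrite <- RPow_abs.
    assert (Hx : x ^ 4 = Rabs x ^ 4) by (rewrite RPow_abs, Rabs_pos_eq; nra).
    rewrite Hx; pose proof (Rabs_pos x).
    assert (0 <= Rabs x ^ 4) by (apply pow_le; lra).
    destruct (Rle_dec 1 (Rabs x)).
    + assert (Rabs x ^ n <= Rabs x ^ 4) by (apply Rle_pow; auto); lra.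
    + assert (Rabs x ^ n <= 1 ^ n) by (apply pow_incr; lra).
      rewrite pow1 in *; lra.
Qed.

Lemma dominated_exp_sqr : dominated (fun x => exp (2 / 5 * x ^ 2)).
Proof.
  split; [intros; apply continuous_exp_sqr |].
  exists 1; intros x; rewrite Rabs_pos_eq; [lra | left; apply exp_pos].
Qed.

Lemma dominated_le f g :
  (forall x, continuous f x) -> (forall x, Rabs (f x) <= g x) -> dominated g -> dominated f.
Proof.
  intros Cf H [_ [K HK]]; split; auto; exists K; intros x.
  eapply Rle_trans; [apply H |]; eapply Rle_trans; [apply Rle_abs | apply HK].
Qed.

(** Adding [K] times the envelope makes the integrand nonnegative and at most [2 K] times the
    envelope, so its integrals are bounded and converge; subtracting the known mean of the envelope
    recovers [f]. *)
Lemma Gmean_correct f : dominated f -> gauss_mean f (Gmean f).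
Proof.
  intros [Cf [K HK]].
  assert (He : forall x, 0 < exp (2 / 5 * x ^ 2)) by (intros; apply exp_pos).
  assert (HK0 : 0 <= K).
  { specialize (HK 0); specialize (He 0); pose proof (Rabs_pos (f 0)); nra. }
  set (g := fun x => phi x * (f x + K * exp (2 / 5 * x ^ 2))).
  assert (Cg : forall x, continuous g x).
  { intros x; apply continuous_phi_mul.
    apply (continuous_plus f (fun x => K * exp (2 / 5 * x ^ 2))); auto.
    apply (continuous_scal_r K (fun x => exp (2 / 5 * x ^ 2))), continuous_exp_sqr. }
  destruct (ex_line_integral_bounded g (2 * K * (sqrt 5 * 4))) as [l Hl]; auto.
  - intros x; specialize (HK x); apply Rabs_le_between in HK.
    apply Rmult_le_pos; [left; apply phi_pos | lra].
  - intros a b Hab.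
    assert (Hex : ex_RInt (fun x => phi x * exp (2 / 5 * x ^ 2)) a b)
      by (apply ex_RInt_continuous_all; intros; apply continuous_phi_mul, continuous_exp_sqr).
    apply Rle_trans with (2 * K * RInt (fun x => phi x * exp (2 / 5 * x ^ 2)) a b).
    + assert (Hs : RInt (fun x => 2 * K * (phi x * exp (2 / 5 * x ^ 2))) a b
                   = 2 * K * RInt (fun x => phi x * exp (2 / 5 * x ^ 2)) a b)
        by exact (RInt_scal (fun x => phi x * exp (2 / 5 * x ^ 2)) a b (2 * K) Hex).
      rewrite <- Hs.
      apply RInt_le; auto.
      * apply ex_RInt_continuous_all; auto.
      * apply (ex_RInt_scal (fun x => phi x * exp (2 / 5 * x ^ 2))); auto.
      * intros x _; unfold g.
        specialize (HK x); apply Rabs_le_between in HK.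
        rewrite (Rmult_comm (2 * K)), Rmult_assoc.
        apply Rmult_le_compat_l; [left; apply phi_pos | lra].
    + apply Rmult_le_compat_l; [lra | apply RInt_phi_exp_sqr_bound].
  - assert (Hf : gauss_mean f (l + - K * sqrt 5)).
    { replace f with (fun x => (f x + K * exp (2 / 5 * x ^ 2)) + - K * exp (2 / 5 * x ^ 2))
        by (apply functional_extensionality; intros; ring).
      apply gauss_mean_plus; [exact Hl |].
      apply gauss_mean_scal, gauss_mean_exp_sqr. }
    now rewrite (gauss_mean_unique f _ Hf).
Qed.

Lemma Gmean_plus f g :
  dominated f -> dominated g -> Gmean (fun x => f x + g x) = Gmean f + Gmean g.
Proof. intros Hf Hg; apply gauss_mean_unique, gauss_mean_plus; now apply Gmean_correct. Qed.

Lemma Gmean_scal f c : dominated f -> Gmean (fun x => c * f x) = c * Gmean f.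
Proof. intros Hf; apply gauss_mean_unique, gauss_mean_scal; now apply Gmean_correct. Qed.

Lemma Gmean_const c : Gmean (fun _ => c) = c.
Proof.
  replace (fun _ : R => c) with (fun _ : R => c * 1)
    by (apply functional_extensionality; intros; ring).
  rewrite (Gmean_scal (fun _ => 1)) by apply dominated_const.
  rewrite (gauss_mean_unique _ _ gauss_mean_1); ring.
Qed.

Lemma Gmean_sqr : Gmean (fun x => x ^ 2) = 1.
Proof. apply gauss_mean_unique, gauss_mean_sqr. Qed.

Lemma Gmean_le f g :
  dominated f -> dominated g -> (forall x, f x <= g x) -> Gmean f <= Gmean g.
Proof.
  intros Hf Hg H.
  assert (0 <= Gmean g + -1 * Gmean f); [| lra].
  apply (gauss_mean_ge_0 (fun x => g x + -1 * f x)).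
  - intros x; specialize (H x); lra.
  - apply gauss_mean_plus; [| apply gauss_mean_scal]; now apply Gmean_correct.
Qed.

Lemma Gmean_affine f a b : dominated f -> Gmean (fun x => a + b * f x) = a + b * Gmean f.
Proof.
  intros Hf.
  rewrite (Gmean_plus (fun _ => a) (fun x => b * f x)), Gmean_const, Gmean_scal; auto.
  - apply dominated_const.
  - now apply dominated_scal.
Qed.

Lemma dominated_affine f a b : dominated f -> dominated (fun x => a + b * f x).
Proof.
  intros Hf; apply (dominated_plus (fun _ => a) (fun x => b * f x)).
  - apply dominated_const.
  - now apply dominated_scal.
Qed.

(** Translating the right-hand integrand by [a] completes the square: [phi (a + x) exp (a (a + x) -
    a^2/2) = phi x]. *)
Lemma Gmean_shift f a :
  dominated f -> dominated (fun x => f (a + x)) ->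
  dominated (fun x => f x * exp (a * x - a ^ 2 / 2)) ->
  Gmean (fun x => f (a + x)) = Gmean (fun x => f x * exp (a * x - a ^ 2 / 2)).
Proof.
  intros Hf Ha He; apply gauss_mean_unique.
  pose proof (line_integral_comp_affine _ 1 a _ (or_introl eq_refl) (Gmean_correct _ He)) as H.
  refine (eq_ind _ (fun g => line_integral g _) H _ _).
  apply functional_extensionality; intros x.
  rewrite Rmult_1_l, (Rplus_comm x a).
  rewrite (Rmult_comm (f (a + x))), <- Rmult_assoc; f_equal.
  unfold phi, Rdiv; rewrite Rmult_assoc, (Rmult_comm (/ sqrt _)), <- Rmult_assoc; f_equal.
  rewrite <- exp_plus; f_equal; field.
Qed.

(** Reflection fixes the Gaussian weight and negates [f], so the mean equals its own negative. *)
Lemma Gmean_odd f : dominated f -> (forall x, f (- x) = - f x) -> Gmean f = 0.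
Proof.
  intros Hf Ho.
  pose proof (line_integral_comp_affine _ (-1) 0 _ (or_intror eq_refl) (Gmean_correct _ Hf)) as H.
  assert (H' : gauss_mean (fun x => -1 * f x) (Gmean f)).
  { refine (eq_ind _ (fun g => line_integral g _) H _ _).
    apply functional_extensionality; intros x.
    assert (Hx : forall y : R, phi (-1 * y + 0) * f (-1 * y + 0) = phi y * (-1 * f y)).
    { intros y; replace (-1 * y + 0) with (- y) by ring; rewrite phi_opp, Ho; ring. }
    apply Hx. }
  apply gauss_mean_unique in H'; rewrite Gmean_scal in H'; auto; lra.
Qed.

(** * Bias and variance of a thresholded square *)

Lemma pos_part_ge_0 x : 0 <= pos_part x.
Proof. apply Rmax_r. Qed.

Lemma pos_part_ge x : x <= pos_part x.
Proof. apply Rmax_l. Qed.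

Lemma pos_part_Rabs x : pos_part x = / 2 * (x + Rabs x).
Proof.
  unfold pos_part, Rmax, Rabs; destruct Rle_dec; destruct Rcase_abs; lra.
Qed.

Lemma pos_part_lip x y : Rabs (pos_part x - pos_part y) <= Rabs (x - y).
Proof.
  unfold pos_part, Rmax, Rabs; repeat destruct Rle_dec; repeat destruct Rcase_abs; lra.
Qed.

Lemma pos_part_scal c x : 0 <= c -> pos_part (c * x) = c * pos_part x.
Proof.
  intros Hc; unfold pos_part; rewrite <- (Rmult_0_r c) at 1; now rewrite RmaxRmult.
Qed.

Definition threshold (t y : R) : R := pos_part (y ^ 2 - t).

Lemma continuous_threshold t a y : continuous (fun y => threshold t (a + y)) y.
Proof.
  apply (continuous_ext (fun y => / 2 * ((a + y) ^ 2 - t + Rabs ((a + y) ^ 2 - t)))).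
  { intros x; symmetry; apply pos_part_Rabs. }
  assert (H : continuous (fun y => (a + y) ^ 2 - t) y)
    by (apply (ex_derive_continuous (fun y => (a + y) ^ 2 - t)); auto_derive; auto).
  apply (continuous_scal_r (/ 2) (fun y => (a + y) ^ 2 - t + Rabs ((a + y) ^ 2 - t))).
  apply (continuous_plus (fun y => (a + y) ^ 2 - t)); auto.
  apply (continuous_comp (fun y => (a + y) ^ 2 - t) Rabs); auto.
  apply continuous_Rabs.
Qed.

Lemma threshold_bounds t y : 0 <= t -> y ^ 2 - t <= threshold t y <= y ^ 2.
Proof.
  intros Ht; pose proof (pow2_ge_0 y); unfold threshold; split; [apply pos_part_ge |].
  apply Rmax_lub; lra.
Qed.

Lemma dominated_threshold t a : 0 <= t -> dominated (fun y => threshold t (a + y)).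
Proof.
  intros Ht; apply (dominated_quartic _ (2 * a ^ 2 + 1) 1); try lra.
  - apply continuous_threshold.
  - pose proof (pow2_ge_0 a); lra.
  - intros y; pose proof (threshold_bounds t (a + y) Ht).
    rewrite Rabs_pos_eq by apply pos_part_ge_0.
    pose proof (pow2_ge_0 (a - y)); pose proof (pow2_ge_0 (y ^ 2 - 1)); simpl in *; nra.
Qed.

Lemma dominated_threshold_sqr t a : 0 <= t -> dominated (fun y => threshold t (a + y) ^ 2).
Proof.
  intros Ht; apply (dominated_quartic _ (8 * a ^ 4) 8); try lra.
  - intros y; apply (continuous_ext (fun y => threshold t (a + y) * threshold t (a + y))).
    { intros x; simpl; now rewrite Rmult_1_r. }
    apply (continuous_mult (fun y => threshold t (a + y)) (fun y => threshold t (a + y)));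
      apply continuous_threshold.
  - pose proof (pow2_ge_0 (a ^ 2)); lra.
  - intros y; rewrite Rabs_pos_eq by apply pow2_ge_0.
    pose proof (threshold_bounds t (a + y) Ht).
    assert (0 <= threshold t (a + y)) by apply pos_part_ge_0.
    apply Rle_trans with (((a + y) ^ 2) ^ 2); [apply pow_incr; lra |].
    assert ((a + y) ^ 2 <= 2 * (a ^ 2 + y ^ 2)) by (pose proof (pow2_ge_0 (a - y)); lra).
    apply Rle_trans with ((2 * (a ^ 2 + y ^ 2)) ^ 2).
    + apply pow_incr; split; [apply pow2_ge_0 | auto].
    + pose proof (pow2_ge_0 (a ^ 2 - y ^ 2)); lra.
Qed.

Lemma dominated_threshold_0 t : 0 <= t -> dominated (threshold t).
Proof.
  intros Ht; replace (threshold t) with (fun y => threshold t (0 + y)).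
  - now apply dominated_threshold.
  - apply functional_extensionality; intros y; now rewrite Rplus_0_l.
Qed.

(** The quantity [D] of the overview, in units where the noise has variance one:
    [Gmean (threshold t)] is the rescaled centring [mu], and division by [n] gives the bias of one
    tail term. *)
Definition threshold_bias (t a : R) : R :=
  Gmean (fun y => threshold t (a + y)) - Gmean (threshold t) - a ^ 2.

Lemma dominated_id : dominated (fun y => y).
Proof.
  replace (fun y : R => y) with (fun y => y ^ 1)
    by (apply functional_extensionality; intros; ring).
  apply dominated_pow; lia.
Qed.

Lemma Gmean_id : Gmean (fun y => y) = 0.
Proof. apply Gmean_odd; [apply dominated_id | reflexivity]. Qed.

Lemma Gmean_quadratic a b c :
  dominated (fun y => a + b * y + c * y ^ 2) /\ Gmean (fun y => a + b * y + c * y ^ 2) = a + c.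
Proof.
  assert (D1 := dominated_affine _ a b dominated_id).
  assert (D2 : dominated (fun y => c * y ^ 2))
    by (apply dominated_scal, dominated_pow; lia).
  split.
  - apply (dominated_plus (fun y => a + b * y) (fun y => c * y ^ 2)); auto.
  - rewrite (Gmean_plus (fun y => a + b * y) (fun y => c * y ^ 2)) by auto.
    rewrite (Gmean_affine (fun y => y)) by apply dominated_id.
    rewrite Gmean_scal, Gmean_id, Gmean_sqr by (apply dominated_pow; lia); ring.
Qed.

(** Quadratics have an exactly known Gaussian mean, in which the linear coefficient averages out;
    hence [b] is absent from the conclusion. *)
Lemma Gmean_le_quadratic f a b c :
  dominated f -> (forall y, f y <= a + b * y + c * y ^ 2) -> Gmean f <= a + c.
Proof.
  intros Hf H; destruct (Gmean_quadratic a b c) as [D <-]; now apply Gmean_le.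
Qed.

Lemma Gmean_ge_quadratic f a b c :
  dominated f -> (forall y, a + b * y + c * y ^ 2 <= f y) -> a + c <= Gmean f.
Proof.
  intros Hf H; destruct (Gmean_quadratic a b c) as [D <-]; now apply Gmean_le.
Qed.

Lemma Gmean_threshold_bounds t a :
  0 <= t -> a ^ 2 + 1 - t <= Gmean (fun y => threshold t (a + y)) <= a ^ 2 + 1.
Proof.
  intros Ht; pose proof (dominated_threshold t a Ht) as D; split.
  - replace (a ^ 2 + 1 - t) with (a ^ 2 - t + 1) by ring.
    apply (Gmean_ge_quadratic _ _ (2 * a)); auto.
    intros y; pose proof (threshold_bounds t (a + y) Ht); lra.
  - apply (Gmean_le_quadratic _ _ (2 * a)); auto.
    intros y; pose proof (threshold_bounds t (a + y) Ht); lra.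
Qed.

Lemma Gmean_threshold_0_bounds t : 0 <= t -> 1 - t <= Gmean (threshold t) <= 1.
Proof.
  intros Ht; pose proof (Gmean_threshold_bounds t 0 Ht) as H.
  replace (fun y => threshold t (0 + y)) with (threshold t) in H; [lra |].
  apply functional_extensionality; intros y; now rewrite Rplus_0_l.
Qed.

Lemma Gmean_threshold_0_ge_0 t : 0 <= t -> 0 <= Gmean (threshold t).
Proof.
  intros Ht; apply (gauss_mean_ge_0 (threshold t)); [intros; apply pos_part_ge_0 |].
  now apply Gmean_correct, dominated_threshold_0.
Qed.

Lemma threshold_bias_le_threshold t a : 0 <= t -> Rabs (threshold_bias t a) <= t.
Proof.
  intros Ht; unfold threshold_bias.
  pose proof (Gmean_threshold_bounds t a Ht); pose proof (Gmean_threshold_0_bounds t Ht).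
  apply Rabs_le; lra.
Qed.

Lemma threshold_diff t a y :
  Rabs (threshold t (a + y) - threshold t y) <= Rabs (2 * a * y + a ^ 2).
Proof.
  replace (2 * a * y + a ^ 2) with ((a + y) ^ 2 - t - (y ^ 2 - t)) by ring.
  apply pos_part_lip.
Qed.

Lemma sqrt_5_le_3 : sqrt 5 <= 3.
Proof.
  rewrite <- (sqrt_pow2 3) by lra; apply sqrt_le_1_alt; lra.
Qed.

(** Away from zero a first-order bound is enough, since [|a| <= 2 a^2] turns the Lipschitz estimate
    into a quadratic one. The mean of the difference is at most [3 a^2 + 2 a^2] in size, and
    subtracting [a^2] gives [6]. *)
Lemma threshold_bias_far t a : 0 <= t -> / 2 < Rabs a -> Rabs (threshold_bias t a) <= 6 * a ^ 2.
Proof.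
  intros Ht Ha.
  assert (Ha2 : Rabs a <= 2 * a ^ 2) by (rewrite <- (pow2_abs a); simpl; nra).
  assert (Hd : forall y, - (a ^ 2 + 2 * a ^ 2 * (1 + y ^ 2)) <=
    threshold t (a + y) - threshold t y <= a ^ 2 + 2 * a ^ 2 * (1 + y ^ 2)).
  { intros y; apply Rabs_le_between; eapply Rle_trans; [apply threshold_diff |].
    eapply Rle_trans; [apply Rabs_triang |].
    rewrite 2!Rabs_mult, (Rabs_pos_eq 2), (Rabs_pos_eq (a ^ 2)) by (try apply pow2_ge_0; lra).
    assert (2 * Rabs y <= 1 + y ^ 2)
      by (rewrite <- (pow2_abs y); pose proof (pow2_ge_0 (Rabs y - 1)); lra).
    pose proof (Rabs_pos a); pose proof (Rabs_pos y); nra. }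
  assert (D1 := dominated_threshold t a Ht); assert (D0 := dominated_threshold_0 t Ht).
  assert (D : dominated (fun y => threshold t (a + y) + -1 * threshold t y))
    by (apply (dominated_plus (fun y => threshold t (a + y))); auto;
        now apply dominated_scal).
  assert (E : Gmean (fun y => threshold t (a + y) + -1 * threshold t y)
    = threshold_bias t a + a ^ 2).
  { rewrite (Gmean_plus (fun y => threshold t (a + y)) (fun y => -1 * threshold t y)),
      Gmean_scal by (auto; now apply dominated_scal).
    unfold threshold_bias; ring. }
  assert (Hu := Gmean_le_quadratic _ (3 * a ^ 2) 0 (2 * a ^ 2) D).
  assert (Hl := Gmean_ge_quadratic _ (- (3 * a ^ 2)) 0 (- (2 * a ^ 2)) D).
  rewrite E in Hu, Hl.
  apply Rabs_le; split.
  - enough (- (3 * a ^ 2) + - (2 * a ^ 2) <= threshold_bias t a + a ^ 2) by lra.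
    apply Hl; intros y; specialize (Hd y); lra.
  - enough (threshold_bias t a + a ^ 2 <= 3 * a ^ 2 + 2 * a ^ 2)
      by (pose proof (pow2_ge_0 a); lra).
    apply Hu; intros y; specialize (Hd y); lra.
Qed.

(** A second-order Taylor bound; the absolute value in the exponent lets one formula serve both
    signs of [u]. *)
Lemma exp_sub_bound u : exp u - 1 - u <= u ^ 2 * exp (Rabs u).
Proof.
  destruct (Rle_dec 0 u) as [Hu | Hu].
  - rewrite Rabs_pos_eq by auto.
    (* The mean value theorem is used twice: [exp u - 1 = u exp c], then [exp c - 1 = c exp d] with
       [d <= c <= u]. *)
    destruct (MVT_gen exp 0 u exp) as [c [Hc E]].
    + intros; apply is_derive_Reals, derivable_pt_lim_exp.
    + intros; apply derivable_continuous_pt, derivable_pt_exp.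
    + rewrite Rmin_left, Rmax_right in Hc by auto; rewrite exp_0 in E.
      destruct (MVT_gen exp 0 c exp) as [d [Hd E']].
      * intros; apply is_derive_Reals, derivable_pt_lim_exp.
      * intros; apply derivable_continuous_pt, derivable_pt_exp.
      * rewrite Rmin_left, Rmax_right in Hd by lra; rewrite exp_0 in E'.
        assert (exp d <= exp u) by (apply exp_le_exp; lra).
        pose proof (exp_pos d).
        replace (exp u - 1 - u) with (u * (exp d * c)) by nra.
        replace (u ^ 2 * exp u) with (u * (exp u * u)) by ring.
        apply Rmult_le_compat_l; auto; apply Rmult_le_compat; lra.
  - assert (Hu' : u < 0) by lra; clear Hu.
    rewrite Rabs_left by auto.
    (* [exp u <= 1 / (1 - u)] *)
    assert (exp u <= 1 + u + u ^ 2).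
    { pose proof (exp_ineq1_le (- u)); pose proof (exp_pos u).
      assert (exp u * exp (- u) = 1) by (rewrite <- exp_plus, Rplus_opp_r; apply exp_0).
      assert (exp u * (1 - u) <= 1) by nra.
      assert (1 <= (1 + u + u ^ 2) * (1 - u)) by (simpl; nra).
      apply Rmult_le_reg_r with (1 - u); lra. }
    assert (1 <= exp (- u)) by (apply exp_ge_1; lra).
    pose proof (pow2_ge_0 u); nra.
Qed.

Lemma abs_mul_half_le a y : Rabs a <= / 2 -> Rabs (a * y) <= y ^ 2 / 8 + / 2.
Proof.
  intros Ha; rewrite Rabs_mult, <- (pow2_abs y).
  pose proof (Rabs_pos y); pose proof (pow2_ge_0 (Rabs y - 2)); nra.
Qed.

Lemma exp_half_le_2 : exp (/ 2) <= 2.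
Proof.
  pose proof exp_le_3; pose proof (exp_pos (/ 2)).
  replace 1 with (/ 2 + / 2) in H by field; rewrite exp_plus in H; nra.
Qed.

(** The budget in the exponent: [exp |a y|] costs [y^2/8] and a factor [exp (1/2) <= 2], while
    [y^4 = 64 (y^2/8)^2] costs [y^2/4] and a factor [64]. The total [3/8] fits under [2/5], and
    [2 * 64 = 128]. *)
Lemma threshold_remainder t a y :
  0 <= t -> Rabs a <= / 2 ->
  threshold t y * ((a * y) ^ 2 * exp (Rabs (a * y))) <= 128 * a ^ 2 * exp (2 / 5 * y ^ 2).
Proof.
  intros Ht Ha.
  pose proof (threshold_bounds t y Ht) as Hb; assert (H0 := pos_part_ge_0 (y ^ 2 - t)).
  fold (threshold t y) in H0.
  assert (He : exp (Rabs (a * y)) <= 2 * exp (y ^ 2 / 8)).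
  { apply Rle_trans with (exp (y ^ 2 / 8 + / 2)).
    - apply exp_le_exp, abs_mul_half_le, Ha.
    - rewrite exp_plus, Rmult_comm; apply Rmult_le_compat_r; [left; apply exp_pos |].
      apply exp_half_le_2. }
  assert (Hq : (y ^ 2 / 8) ^ 2 <= exp (2 * (y ^ 2 / 8)))
    by (apply sqr_le_exp; pose proof (pow2_ge_0 y); lra).
  assert (Hs : exp (2 * (y ^ 2 / 8)) * exp (y ^ 2 / 8) <= exp (2 / 5 * y ^ 2)).
  { rewrite <- exp_plus; apply exp_le_exp; pose proof (pow2_ge_0 y); lra. }
  pose proof (pow2_ge_0 (a * y)); pose proof (exp_pos (Rabs (a * y))).
  pose proof (exp_pos (y ^ 2 / 8)); pose proof (pow2_ge_0 (y ^ 2 / 8)).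
  apply Rle_trans with (y ^ 2 * ((a * y) ^ 2 * (2 * exp (y ^ 2 / 8)))).
  { apply Rmult_le_compat; [auto | apply Rmult_le_pos; lra | lra |].
    apply Rmult_le_compat_l; auto. }
  replace (y ^ 2 * ((a * y) ^ 2 * (2 * exp (y ^ 2 / 8))))
    with (128 * a ^ 2 * ((y ^ 2 / 8) ^ 2 * exp (y ^ 2 / 8))) by field.
  apply Rmult_le_compat_l; [pose proof (pow2_ge_0 a); lra |].
  eapply Rle_trans; [| apply Hs].
  apply Rmult_le_compat_r; lra.
Qed.

(** The tilted integrand [f] is squeezed between [L] and [U], whose means are known and differ from
    that of [threshold t] only at order [a^2]. The upper bound also supplies the domination of [f]
    that the change of measure requires. *)
Lemma threshold_bias_near t a : 0 <= t -> Rabs a <= / 2 -> Rabs (threshold_bias t a) <= 384 * a ^ 2.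
Proof.
  intros Ht Ha.
  assert (D0 := dominated_threshold_0 t Ht).
  assert (Hh : forall y, 0 <= threshold t y) by (intros; apply pos_part_ge_0).
  assert (Dy : dominated (fun y => y * threshold t y)).
  { apply (dominated_quartic _ 1 1); try lra.
    - intros x; apply (continuous_mult (fun y => y) (threshold t));
        [apply continuous_id | apply D0].
    - intros y; rewrite Rabs_mult, (Rabs_pos_eq (threshold _ _)) by auto.
      pose proof (threshold_bounds t y Ht); pose proof (Rabs_pos y).
      apply Rle_trans with (Rabs y * y ^ 2); [apply Rmult_le_compat_l; lra |].
      replace (y ^ 4) with ((y ^ 2) ^ 2) by ring; rewrite <- (pow2_abs y).
      pose proof (pow2_ge_0 (Rabs y ^ 2 - 1)); pose proof (pow2_ge_0 (Rabs y - 1)); nra. }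
  assert (Ey : Gmean (fun y => y * threshold t y) = 0).
  { apply Gmean_odd; auto; intros y.
    unfold threshold; replace ((- y) ^ 2) with (y ^ 2) by ring; ring. }
  set (f := fun y => threshold t y * exp (a * y - a ^ 2 / 2)).
  (* From [exp u >= 1 + u] with the whole exponent as [u]. The linear part is odd and averages out,
     leaving a loss of [a^2/2] times a mean that is at most [1]. *)
  set (L := fun y => threshold t y + (a * (y * threshold t y) + - (a ^ 2 / 2) * threshold t y)).
  assert (DL : dominated L).
  { apply (dominated_plus (threshold t)); auto.
    apply (dominated_plus (fun y => a * (y * threshold t y))); now apply dominated_scal. }
  assert (EL : Gmean L = Gmean (threshold t) - a ^ 2 / 2 * Gmean (threshold t)).
  { unfold L; rewrite (Gmean_plus (threshold t)
      (fun y => a * (y * threshold t y) + - (a ^ 2 / 2) * threshold t y)),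
      (Gmean_plus (fun y => a * (y * threshold t y))), !Gmean_scal, Ey;
      auto; try (now apply dominated_scal); [ring |].
    apply (dominated_plus (fun y => a * (y * threshold t y))); now apply dominated_scal. }
  (* From the second-order bound at [u = a y], after dropping the factor [exp (- a^2/2) <= 1]; the
     remainder is replaced by a multiple of the envelope. *)
  set (U := fun y => threshold t y + (a * (y * threshold t y)
              + 128 * a ^ 2 * exp (2 / 5 * y ^ 2))).
  assert (DU' : dominated (fun y => a * (y * threshold t y) + 128 * a ^ 2 * exp (2 / 5 * y ^ 2))).
  { apply (dominated_plus (fun y => a * (y * threshold t y))); apply dominated_scal; auto.
    apply dominated_exp_sqr. }
  assert (DU : dominated U) by now apply (dominated_plus (threshold t)).
  assert (EU : Gmean U = Gmean (threshold t) + 128 * a ^ 2 * sqrt 5).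
  { unfold U; rewrite (Gmean_plus (threshold t)
      (fun y => a * (y * threshold t y) + 128 * a ^ 2 * exp (2 / 5 * y ^ 2))) by auto.
    rewrite (Gmean_plus (fun y => a * (y * threshold t y))
      (fun y => 128 * a ^ 2 * exp (2 / 5 * y ^ 2)))
      by (apply dominated_scal; auto; apply dominated_exp_sqr).
    rewrite (Gmean_scal (fun y => exp (2 / 5 * y ^ 2))) by apply dominated_exp_sqr.
    rewrite Gmean_scal by auto.
    rewrite Ey, (gauss_mean_unique _ _ gauss_mean_exp_sqr); ring. }
  assert (HL : forall y, L y <= f y).
  { intros y; unfold L, f.
    pose proof (exp_ineq1_le (a * y - a ^ 2 / 2)); specialize (Hh y); nra. }
  assert (HU : forall y, f y <= U y).
  { intros y; unfold U, f.
    pose proof (threshold_remainder t a y Ht Ha).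
    pose proof (exp_sub_bound (a * y)).
    assert (exp (a * y - a ^ 2 / 2) <= exp (a * y))
      by (apply exp_le_exp; pose proof (pow2_ge_0 a); lra).
    specialize (Hh y).
    apply Rle_trans with (threshold t y * (1 + a * y + (a * y) ^ 2 * exp (Rabs (a * y)))).
    - apply Rmult_le_compat_l; lra.
    - lra. }
  assert (Df : dominated f).
  { apply (dominated_le f U); auto.
    - intros y; apply (continuous_mult (threshold t) (fun y => exp (a * y - a ^ 2 / 2)));
        [apply D0 |].
      apply (ex_derive_continuous (fun y => exp (a * y - a ^ 2 / 2))); auto_derive; auto.
    - intros y; rewrite Rabs_pos_eq; auto.
      apply Rmult_le_pos; auto; left; apply exp_pos. }
  assert (ES : Gmean (fun y => threshold t (a + y)) = Gmean f)
    by (apply Gmean_shift; auto; now apply dominated_threshold).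
  assert (H1 := Gmean_le _ _ DL Df HL); assert (H2 := Gmean_le _ _ Df DU HU).
  rewrite <- ES, EL in H1; rewrite <- ES, EU in H2.
  unfold threshold_bias.
  pose proof (Gmean_threshold_0_bounds t Ht); pose proof (Gmean_threshold_0_ge_0 t Ht).
  (* The constant [384] is [128 * 3], the upper estimate being the larger of the two. *)
  pose proof sqrt_5_le_3; pose proof (pow2_ge_0 a).
  apply Rabs_le; split; nra.
Qed.

Lemma threshold_bias_le_sqr t a : 0 <= t -> Rabs (threshold_bias t a) <= 384 * a ^ 2.
Proof.
  intros Ht; destruct (Rle_dec (Rabs a) (/ 2)).
  - now apply threshold_bias_near.
  - pose proof (threshold_bias_far t a Ht); pose proof (pow2_ge_0 a); lra.
Qed.

Definition Gvar (f : R -> R) : R := Gmean (fun y => f y ^ 2) - Gmean f ^ 2.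

Lemma Gmean_sqr_affine f a b :
  dominated f -> dominated (fun y => f y ^ 2) ->
  dominated (fun y => (a + b * f y) ^ 2) /\
  Gmean (fun y => (a + b * f y) ^ 2) = (a + b * Gmean f) ^ 2 + b ^ 2 * Gvar f.
Proof.
  intros D D2.
  assert (D1 := dominated_affine f (a ^ 2) (2 * a * b) D).
  assert (D3 := dominated_scal _ (b ^ 2) D2).
  replace (fun y => (a + b * f y) ^ 2)
    with (fun y => a ^ 2 + 2 * a * b * f y + b ^ 2 * f y ^ 2)
    by (apply functional_extensionality; intros; ring).
  split; [now apply (dominated_plus (fun y => a ^ 2 + 2 * a * b * f y)) |].
  rewrite (Gmean_plus (fun y => a ^ 2 + 2 * a * b * f y)), Gmean_affine,
    (Gmean_scal (fun y => f y ^ 2)) by auto.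
  unfold Gvar; ring.
Qed.

(** A variance is at most the mean square distance to any [c], so a convenient centre can stand in
    for the mean, which has no closed form here. *)
Lemma Gvar_le f c :
  dominated f -> dominated (fun y => f y ^ 2) -> Gvar f <= Gmean (fun y => (- c + 1 * f y) ^ 2).
Proof.
  intros D D2; destruct (Gmean_sqr_affine f (- c) 1 D D2) as [_ ->].
  pose proof (pow2_ge_0 (- c + 1 * Gmean f)); lra.
Qed.

Lemma Gmean_pow4_le : Gmean (fun y => y ^ 4) <= 75.
Proof.
  apply Rle_trans with (Gmean (fun y => 25 * exp (2 / 5 * y ^ 2))).
  - apply Gmean_le; [apply dominated_pow; lia | apply dominated_scal, dominated_exp_sqr |].
    apply pow4_le_exp.
  - rewrite Gmean_scal, (gauss_mean_unique _ _ gauss_mean_exp_sqr) by apply dominated_exp_sqr.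
    pose proof sqrt_5_le_3; lra.
Qed.

(** The decay in [t] is extracted pointwise: apply [v^2 <= exp (2 v)] to [v = (y^2 - t)/5] where the
    threshold is exceeded. It replaces a Gaussian tail estimate. *)
Lemma threshold_sqr_le_exp t y : threshold t y ^ 2 <= 25 * exp (- (2 / 5) * t) * exp (2 / 5 * y ^ 2).
Proof.
  rewrite Rmult_assoc, <- exp_plus.
  replace (- (2 / 5) * t + 2 / 5 * y ^ 2) with (2 * ((y ^ 2 - t) / 5)) by field.
  unfold threshold, pos_part, Rmax; destruct Rle_dec.
  - pose proof (exp_pos (2 * ((y ^ 2 - t) / 5))); rewrite pow_i by lia; lra.
  - replace ((y ^ 2 - t) ^ 2) with (25 * ((y ^ 2 - t) / 5) ^ 2) by field.
    apply Rmult_le_compat_l; [lra | apply sqr_le_exp; lra].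
Qed.

Lemma threshold_var t a :
  0 <= t -> Gvar (fun y => threshold t (a + y)) <= 160 * a ^ 2 + 150 * exp (- (2 / 5) * t).
Proof.
  intros Ht.
  assert (D := dominated_threshold t a Ht); assert (D2 := dominated_threshold_sqr t a Ht).
  pose proof (exp_pos (- (2 / 5) * t)) as Hexp.
  assert (Dq := dominated_pow 2 ltac:(lia)); assert (Dq4 := dominated_pow 4 ltac:(lia)).
  destruct (Rle_dec 1 (Rabs a)) as [Ha | Ha].
  (* A strong signal is compared with its noiseless value. The resulting [8 a^2 + 150] is absorbed
     into [160 a^2] because [a^2 >= 1]. *)
  - set (c := threshold t a).
    eapply Rle_trans; [apply (Gvar_le _ c D D2) |].
    apply Rle_trans with (Gmean (fun y => 8 * a ^ 2 * y ^ 2 + 2 * y ^ 4)).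
    + apply Gmean_le.
      * now apply Gmean_sqr_affine.
      * apply (dominated_plus (fun y => 8 * a ^ 2 * y ^ 2)); now apply dominated_scal.
      * intros y.
        pose proof (threshold_diff t y a) as H; fold c in H; rewrite (Rplus_comm y a) in H.
        rewrite <- (pow2_abs (- c + _)).
        replace (- c + 1 * threshold t (a + y)) with (threshold t (a + y) - c) by ring.
        apply Rle_trans with (Rabs (2 * y * a + y ^ 2) ^ 2).
        -- apply pow_incr; split; [apply Rabs_pos | auto].
        -- rewrite pow2_abs; pose proof (pow2_ge_0 (2 * y * a - y ^ 2)); nra.
    + rewrite (Gmean_plus (fun y => 8 * a ^ 2 * y ^ 2)), !Gmean_scal, Gmean_sqr
        by (auto; now apply dominated_scal).
      pose proof Gmean_pow4_le.
      assert (1 <= a ^ 2) by (rewrite <- pow2_abs; simpl; nra).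
      lra.
  - assert (a ^ 2 <= 1).
    { rewrite <- pow2_abs; pose proof (Rabs_pos a); simpl; nra. }
    (* With a weak signal and centre [0], the term splits into the shift [d], of mean square of
       order [a^2], and the pure-noise value, which carries the factor [exp (- (2/5) t)]; here
       [50 sqrt 5 <= 150]. *)
    eapply Rle_trans; [apply (Gvar_le _ 0 D D2) |].
    assert (Dr : dominated (fun y => 50 * exp (- (2 / 5) * t) * exp (2 / 5 * y ^ 2)))
      by (apply dominated_scal, dominated_exp_sqr).
    assert (Dl := dominated_affine _ (4 * a ^ 4) (16 * a ^ 2) Dq).
    apply Rle_trans with (Gmean (fun y => (4 * a ^ 4 + 16 * a ^ 2 * y ^ 2)
      + 50 * exp (- (2 / 5) * t) * exp (2 / 5 * y ^ 2))).
    + apply Gmean_le.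
      * now apply Gmean_sqr_affine.
      * now apply (dominated_plus (fun y => 4 * a ^ 4 + 16 * a ^ 2 * y ^ 2)).
      * intros y.
        pose proof (threshold_sqr_le_exp t y).
        set (d := threshold t (a + y) - threshold t y).
        assert (d ^ 2 <= 8 * a ^ 2 * y ^ 2 + 2 * a ^ 4).
        { rewrite <- pow2_abs.
          apply Rle_trans with (Rabs (2 * a * y + a ^ 2) ^ 2).
          - apply pow_incr; split; [apply Rabs_pos | apply threshold_diff].
          - rewrite pow2_abs; pose proof (pow2_ge_0 (2 * a * y - a ^ 2)); nra. }
        replace (- 0 + 1 * threshold t (a + y)) with (d + threshold t y) by (unfold d; ring).
        pose proof (pow2_ge_0 (d - threshold t y)); nra.
    + rewrite (Gmean_plus (fun y => 4 * a ^ 4 + 16 * a ^ 2 * y ^ 2)), Gmean_affine,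
        Gmean_scal, Gmean_sqr, (gauss_mean_unique _ _ gauss_mean_exp_sqr)
        by (auto; apply dominated_exp_sqr).
      pose proof sqrt_5_le_3.
      assert (a ^ 4 <= a ^ 2) by (replace (a ^ 4) with (a ^ 2 * a ^ 2) by ring;
        pose proof (pow2_ge_0 a); nra).
      pose proof (pow2_ge_0 a); nra.
Qed.

(** * Risk decomposition *)

Lemma sum_n_m_last (a : nat -> R) n m :
  (n <= S m)%nat -> sum_n_m a n (S m) = sum_n_m a n m + a (S m).
Proof. intros H; now rewrite sum_n_Sm. Qed.

Lemma sum_n_m_empty (a : nat -> R) n m : (m < n)%nat -> sum_n_m a n m = 0.
Proof. intros H; now apply (sum_n_m_zero a). Qed.

Lemma sum_n_m_le_loc (a b : nat -> R) n m :
  (forall k, (n <= k <= m)%nat -> a k <= b k) -> sum_n_m a n m <= sum_n_m b n m.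
Proof.
  induction m as [|m IH]; intros H.
  - destruct n as [|n].
    + rewrite 2!sum_n_n; apply H; lia.
    + rewrite 2!sum_n_m_empty by lia; lra.
  - destruct (le_lt_dec n (S m)).
    + rewrite 2!sum_n_m_last by auto.
      apply Rplus_le_compat; [apply IH; intros; apply H; lia | apply H; lia].
    + rewrite 2!sum_n_m_empty by lia; lra.
Qed.

Lemma sum_n_m_ge_0 (a : nat -> R) n m :
  (forall k, (n <= k <= m)%nat -> 0 <= a k) -> 0 <= sum_n_m a n m.
Proof.
  intros H; apply Rle_trans with (sum_n_m (fun _ => 0) n m).
  - rewrite sum_n_m_const, Rmult_0_r; lra.
  - now apply sum_n_m_le_loc.
Qed.

Lemma sum_n_m_split (a : nat -> R) n k m :
  (n <= S k)%nat -> (k <= m)%nat -> sum_n_m a n m = sum_n_m a n k + sum_n_m a (S k) m.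
Proof. intros; now rewrite (sum_n_m_Chasles a n k m). Qed.

Lemma sum_n_m_incl (a : nat -> R) n m n' m' :
  (n' <= n)%nat -> (m <= m')%nat -> (forall k, 0 <= a k) ->
  sum_n_m a n m <= sum_n_m a n' m'.
Proof.
  intros Hn Hm Ha.
  destruct (le_lt_dec n m) as [H | H].
  - destruct n as [|n].
    + replace n' with 0%nat by lia.
      rewrite (sum_n_m_split a 0 m m') by lia.
      pose proof (sum_n_m_ge_0 a (S m) m' (fun k _ => Ha k)); lra.
    + rewrite (sum_n_m_split a n' m m'), (sum_n_m_split a n' n m) by lia.
      pose proof (sum_n_m_ge_0 a (S m) m' (fun k _ => Ha k)).
      pose proof (sum_n_m_ge_0 a n' n (fun k _ => Ha k)); lra.
  - rewrite sum_n_m_empty by auto; now apply sum_n_m_ge_0.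
Qed.

Lemma sum_n_m_Rabs (a : nat -> R) n m :
  Rabs (sum_n_m a n m) <= sum_n_m (fun k => Rabs (a k)) n m.
Proof. apply (norm_sum_n_m a n m). Qed.

Lemma sum_n_m_add (a b : nat -> R) n m :
  sum_n_m (fun k => a k + b k) n m = sum_n_m a n m + sum_n_m b n m.
Proof. apply (sum_n_m_plus a b). Qed.

Lemma sum_n_m_scal (a : nat -> R) c n m :
  sum_n_m (fun k => c * a k) n m = c * sum_n_m a n m.
Proof. apply (sum_n_m_mult_l c a). Qed.

Lemma sum_n_m_cst c n m : sum_n_m (fun _ : nat => c) n m = INR (S m - n) * c.
Proof. apply sum_n_m_const. Qed.

(** Independence is built into the iterated integral. The last coordinate is the outermost variable
    and is frozen inside, so it can join the constant; this is why the induction is over all [c].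
    What the inner integrals return is a constant plus a square affine in [g (S k) x], whose mean is
    known. *)
Lemma gexp_sum_sqr (g : nat -> R -> R) (k : nat) (c : R) :
  (forall i, (1 <= i <= k)%nat -> dominated (g i) /\ dominated (fun y => g i y ^ 2)) ->
  gexp k (fun z => (c + sum_n_m (fun i => g i (z i)) 1 k) ^ 2) =
  (c + sum_n_m (fun i => Gmean (g i)) 1 k) ^ 2 + sum_n_m (fun i => Gvar (g i)) 1 k.
Proof.
  revert c; induction k as [|k IH]; intros c Hg.
  - simpl gexp; rewrite !sum_n_m_empty by lia; ring.
  - destruct (Hg (S k)) as [D D2]; [lia |].
    set (e := sum_n_m (fun i => Gmean (g i)) 1 k).
    set (v := sum_n_m (fun i => Gvar (g i)) 1 k).
    destruct (Gmean_sqr_affine (g (S k)) (c + e) 1 D D2) as [D3 E].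
    transitivity (Gmean (fun x => v + 1 * (c + e + 1 * g (S k) x) ^ 2)).
    + simpl gexp; unfold Gmean; f_equal; apply functional_extensionality; intros x; f_equal.
      transitivity (gexp k (fun z => (c + g (S k) x + sum_n_m (fun i => g i (z i)) 1 k) ^ 2)).
      * f_equal; apply functional_extensionality; intros z.
        rewrite sum_n_m_last by lia.
        rewrite (sum_n_m_ext_loc _ (fun i => g i (z i))).
        -- unfold upd; rewrite Nat.eqb_refl; ring.
        -- intros i Hi; unfold upd; replace (Nat.eqb i (S k)) with false; auto.
           symmetry; apply Nat.eqb_neq; lia.
      * rewrite IH by (intros; apply Hg; lia); unfold e, v; ring.
    + rewrite (Gmean_affine (fun x => (c + e + 1 * g (S k) x) ^ 2)) by auto.
      rewrite E, !sum_n_m_last by lia; fold e v; ring.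
Qed.

Lemma Gvar_affine f a b :
  dominated f -> dominated (fun y => f y ^ 2) -> Gvar (fun y => a + b * f y) = b ^ 2 * Gvar f.
Proof.
  intros D D2; unfold Gvar at 1.
  destruct (Gmean_sqr_affine f a b D D2) as [_ ->]; rewrite Gmean_affine by auto; ring.
Qed.

Lemma observation_sqr n th z :
  0 < n -> (th + z / sqrt n) ^ 2 = / n * (sqrt n * th + z) ^ 2.
Proof.
  intros Hn; assert (H : sqrt n ^ 2 = n) by (apply pow2_sqrt; lra).
  assert (0 < sqrt n) by (now apply sqrt_lt_R0).
  rewrite <- H at 2; field; lra.
Qed.

Definition head_term (n th z : R) : R := (th + z / sqrt n) ^ 2 - / n.

Definition tail_term (n tau mu th z : R) : R := pos_part ((th + z / sqrt n) ^ 2 - tau / n) - mu.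

(** A head term is the case [t = 0] of the thresholded square, where the positive part does nothing.
    The variance constant is [152 = 2 + 2 * 75], from [(2 a y + (y^2 - 1))^2 <= 8 a^2 y^2 + 2 y^4 +
    2]. *)
Lemma head_term_stats n th :
  0 < n ->
  dominated (head_term n th) /\ dominated (fun z => head_term n th z ^ 2) /\
  Gmean (head_term n th) = th ^ 2 /\ Gvar (head_term n th) <= 8 * (th ^ 2 / n) + 152 / n ^ 2.
Proof.
  intros Hn; set (a := sqrt n * th).
  assert (Ha : a ^ 2 = n * th ^ 2)
    by (unfold a; rewrite Rpow_mult_distr, pow2_sqrt; lra).
  assert (Hf : head_term n th = (fun z => - / n + / n * threshold 0 (a + z))).
  { apply functional_extensionality; intros z; unfold head_term, threshold.
    rewrite observation_sqr by auto; fold a.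
    unfold pos_part; rewrite Rmax_left by (pose proof (pow2_ge_0 (a + z)); lra); ring. }
  assert (D := dominated_threshold 0 a (Rle_refl 0)).
  assert (D2 := dominated_threshold_sqr 0 a (Rle_refl 0)).
  assert (E : (fun y => threshold 0 (a + y)) = (fun y => a ^ 2 + 2 * a * y + 1 * y ^ 2)).
  { apply functional_extensionality; intros y; unfold threshold, pos_part.
    rewrite Rmax_left by (pose proof (pow2_ge_0 (a + y)); lra); ring. }
  rewrite Hf; repeat split.
  - now apply dominated_affine.
  - now apply dominated_affine.
  - apply (Gmean_sqr_affine _ (- / n) (/ n) D D2).
  - apply (Gmean_sqr_affine _ (- / n) (/ n) D D2).
  - rewrite Gmean_affine, E by auto.
    destruct (Gmean_quadratic (a ^ 2) (2 * a) 1) as [_ ->]; rewrite Ha; field; lra.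
  - rewrite Gvar_affine by auto.
    apply Rle_trans with ((/ n) ^ 2 * (8 * a ^ 2 + 152)).
    2: right; rewrite Ha; field; lra.
    apply Rmult_le_compat_l; [apply pow2_ge_0 |].
    eapply Rle_trans; [apply (Gvar_le _ (a ^ 2 + 1) D D2) |].
    assert (Dq := dominated_pow 2 ltac:(lia)); assert (Dq4 := dominated_pow 4 ltac:(lia)).
    assert (Dl := dominated_affine _ 2 (8 * a ^ 2) Dq).
    apply Rle_trans with (Gmean (fun y => (2 + 8 * a ^ 2 * y ^ 2) + 2 * y ^ 4)).
    + apply Gmean_le.
      * now apply Gmean_sqr_affine.
      * apply (dominated_plus (fun y => 2 + 8 * a ^ 2 * y ^ 2)); auto.
        now apply dominated_scal.
      * intros y; apply (f_equal (fun h => h y)) in E; simpl in E.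
        replace (threshold 0 (a + y)) with (a ^ 2 + 2 * a * y + 1 * y ^ 2)
          by (rewrite E; ring).
        pose proof (pow2_ge_0 (2 * a * y - (y ^ 2 - 1))).
        pose proof (pow2_ge_0 y); nra.
    + rewrite (Gmean_plus (fun y => 2 + 8 * a ^ 2 * y ^ 2)), Gmean_affine,
        Gmean_scal, Gmean_sqr by (auto; now apply dominated_scal).
      pose proof Gmean_pow4_le; lra.
Qed.

Lemma tail_term_scaling n tau mu th :
  0 < n -> tail_term n tau mu th = (fun z => - mu + / n * threshold tau (sqrt n * th + z)).
Proof.
  intros Hn; apply functional_extensionality; intros z; unfold tail_term, threshold.
  rewrite observation_sqr by auto.
  replace (/ n * (sqrt n * th + z) ^ 2 - tau / n)
    with (/ n * ((sqrt n * th + z) ^ 2 - tau)) by (field; lra).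
  rewrite pos_part_scal by (left; now apply Rinv_0_lt_compat); ring.
Qed.

(** The centring is spelled out as a Gaussian mean so that it agrees by unfolding with the [mu] of
    the estimator; it leaves [th ^ 2] plus the rescaled bias as the mean. *)
Lemma tail_term_stats n tau th :
  0 < n -> 0 <= tau ->
  let mu := Gmean (fun z => pos_part ((z / sqrt n) ^ 2 - tau / n)) in
  dominated (tail_term n tau mu th) /\ dominated (fun z => tail_term n tau mu th z ^ 2) /\
  Gmean (tail_term n tau mu th) = th ^ 2 + threshold_bias tau (sqrt n * th) / n /\
  Gvar (tail_term n tau mu th) <= 160 * (th ^ 2 / n) + 150 / n ^ 2 * exp (- (2 / 5) * tau).
Proof.
  intros Hn Ht mu.
  assert (Hmu : mu = / n * Gmean (threshold tau)).
  (* With zero signal and zero centring the scaling identity becomes one for the integrand of the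
     centring itself. *)
  { assert (H := tail_term_scaling n tau 0 0 Hn).
    unfold mu; rewrite <- Gmean_scal by (now apply dominated_threshold_0).
    f_equal; apply functional_extensionality; intros z.
    apply (f_equal (fun h => h z)) in H; unfold tail_term in H.
    rewrite Rmult_0_r, !Rplus_0_l in H; rewrite Ropp_0, Rplus_0_l in H; lra. }
  rewrite tail_term_scaling by auto; set (a := sqrt n * th).
  assert (Ha : a ^ 2 = n * th ^ 2)
    by (unfold a; rewrite Rpow_mult_distr, pow2_sqrt; lra).
  assert (D := dominated_threshold tau a Ht); assert (D2 := dominated_threshold_sqr tau a Ht).
  split; [now apply dominated_affine |].
  split; [now apply Gmean_sqr_affine |].
  split.
  - rewrite Gmean_affine by auto; unfold threshold_bias; rewrite Hmu, Ha; field; lra.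
  - rewrite Gvar_affine by auto.
    apply Rle_trans with ((/ n) ^ 2 * (160 * a ^ 2 + 150 * exp (- (2 / 5) * tau))).
    + apply Rmult_le_compat_l; [apply pow2_ge_0 | now apply threshold_var].
    + right; rewrite Ha; field; lra.
Qed.

Lemma risk3_le p alpha n J theta :
  let m := m3 p alpha n in
  let N := (2 ^ J * m)%nat in
  (1 <= n)%nat ->
  (forall i, (S m <= i <= N)%nat -> 0 <= tau p alpha n i) ->
  risk3 p alpha n J theta <=
  (sum_n_m (fun i => theta i ^ 2) 1 N - Qfun theta
   + sum_n_m (fun i => threshold_bias (tau p alpha n i) (sqrt (INR n) * theta i) / INR n) (S m) N) ^ 2
  + (160 / INR n * sum_n_m (fun i => theta i ^ 2) 1 N + 152 / INR n ^ 2 * INR m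
     + 150 / INR n ^ 2 * sum_n_m (fun i => exp (- (2 / 5) * tau p alpha n i)) (S m) N).
Proof.
  intros m N Hn Ht.
  assert (Hn0 : 0 < INR n) by (apply lt_0_INR; lia).
  assert (HmN : (m <= N)%nat).
  { unfold N; pose proof (Nat.pow_nonzero 2 J); nia. }
  (* Gluing head and tail into one family makes the estimator a single separable sum, the shape that
     [gexp_sum_sqr] evaluates. *)
  set (g := fun i => if Nat.leb i m then head_term (INR n) (theta i)
                     else tail_term (INR n) (tau p alpha n i) (mu p alpha n i) (theta i)).
  assert (Hg1 : forall i, (i <= m)%nat -> g i = head_term (INR n) (theta i)).
  { intros i Hi; unfold g; now rewrite (proj2 (Nat.leb_le i m) Hi). }
  assert (Hg2 : forall i, (m < i)%nat ->
    g i = tail_term (INR n) (tau p alpha n i) (mu p alpha n i) (theta i)).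
  { intros i Hi; unfold g; now rewrite (proj2 (Nat.leb_gt i m) Hi). }
  assert (HD : forall i, (1 <= i <= N)%nat -> dominated (g i) /\ dominated (fun y => g i y ^ 2)).
  { intros i Hi; destruct (le_lt_dec i m) as [H | H].
    - rewrite Hg1 by auto; now split; apply head_term_stats.
    - rewrite Hg2 by auto.
      pose proof (tail_term_stats (INR n) (tau p alpha n i) (theta i) Hn0 (Ht i ltac:(lia))).
      split; apply H0. }
  assert (Hrisk : risk3 p alpha n J theta
     = gexp N (fun z => (- Qfun theta + sum_n_m (fun i => g i (z i)) 1 N) ^ 2)).
  { unfold risk3; fold m; fold N; f_equal; apply functional_extensionality; intros z.
    f_equal; unfold Qhat3; fold m; fold N.
    rewrite (sum_n_m_split (fun i => g i (z i)) 1 m N) by lia.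
    rewrite (sum_n_m_ext_loc (fun i => g i (z i)) (fun i => head_term (INR n) (theta i) (z i)) 1 m)
      by (intros; rewrite Hg1 by lia; reflexivity).
    rewrite (sum_n_m_ext_loc (fun i => g i (z i)) (fun i =>
      tail_term (INR n) (tau p alpha n i) (mu p alpha n i) (theta i) (z i)) (S m) N)
      by (intros; rewrite Hg2 by lia; reflexivity).
    unfold head_term, tail_term; ring. }
  rewrite Hrisk, gexp_sum_sqr by auto.
  apply Rplus_le_compat.
  - right; f_equal.
    rewrite (sum_n_m_split (fun i => theta i ^ 2) 1 m N),
      (sum_n_m_split (fun i => Gmean (g i)) 1 m N) by lia.
    rewrite (sum_n_m_ext_loc (fun i => Gmean (g i)) (fun i => theta i ^ 2) 1 m)
      by (intros; rewrite Hg1 by lia; now apply head_term_stats).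
    rewrite (sum_n_m_ext_loc (fun i => Gmean (g i)) (fun i => theta i ^ 2 +
      threshold_bias (tau p alpha n i) (sqrt (INR n) * theta i) / INR n) (S m) N).
    + rewrite sum_n_m_add; ring.
    + intros i Hi; rewrite Hg2 by lia.
      apply (tail_term_stats (INR n) (tau p alpha n i) (theta i)); auto.
  - rewrite (sum_n_m_split (fun i => theta i ^ 2) 1 m N),
      (sum_n_m_split (fun i => Gvar (g i)) 1 m N) by lia.
    (* The head coefficient [8] is relaxed to the [160] of the tail, so that the signal energy
       enters as one sum up to [N]. *)
    assert (H1 : sum_n_m (fun i => Gvar (g i)) 1 m <=
      sum_n_m (fun i => 160 / INR n * theta i ^ 2 + 152 / INR n ^ 2) 1 m).
    { apply sum_n_m_le_loc; intros i Hi; rewrite Hg1 by lia.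
      destruct (head_term_stats (INR n) (theta i) Hn0) as [_ [_ [_ H]]].
      eapply Rle_trans; [apply H |].
      assert (0 <= theta i ^ 2 / INR n)
        by (apply Rdiv_le_0_compat; [apply pow2_ge_0 | auto]).
      unfold Rdiv in *; lra. }
    assert (H2 : sum_n_m (fun i => Gvar (g i)) (S m) N <=
      sum_n_m (fun i => 160 / INR n * theta i ^ 2
                 + 150 / INR n ^ 2 * exp (- (2 / 5) * tau p alpha n i)) (S m) N).
    { apply sum_n_m_le_loc; intros i Hi; rewrite Hg2 by lia.
      pose proof (tail_term_stats (INR n) (tau p alpha n i) (theta i) Hn0 (Ht i Hi))
        as [_ [_ [_ H]]].
      eapply Rle_trans; [apply H |].
      unfold Rdiv; lra. }
    rewrite sum_n_m_add, sum_n_m_scal, sum_n_m_cst in H1.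
    rewrite sum_n_m_add, !sum_n_m_scal in H2.
    replace (S m - 1)%nat with m in H1 by lia.
    lra.
Qed.

(** * The parameter balls *)

Lemma Rpower_pos x y : 0 < Rpower x y.
Proof. apply exp_pos. Qed.

Lemma Rpower_le_base a b c : 0 < a -> a <= b -> 0 <= c -> Rpower a c <= Rpower b c.
Proof. intros; apply Rle_Rpower_l; lra. Qed.

Lemma Rpower_neg_le_base a b c : 0 < a -> a <= b -> 0 <= c -> Rpower b (- c) <= Rpower a (- c).
Proof.
  intros Ha Hb Hc; rewrite 2!Rpower_Ropp.
  apply Rinv_le_contravar; [apply Rpower_pos | now apply Rpower_le_base].
Qed.

Lemma Rpower_sqr x y : Rpower x y ^ 2 = Rpower x (2 * y).
Proof.
  replace (2 * y) with (y + y) by ring; rewrite Rpower_plus; ring.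
Qed.

Lemma rpow_pos_eq x y : 0 < x -> rpow x y = Rpower x y.
Proof. intros H; unfold rpow; destruct Req_EM_T; auto; lra. Qed.

Lemma rpow_0 y : rpow 0 y = 0.
Proof. unfold rpow; destruct Req_EM_T; auto; lra. Qed.

Lemma rpow_ge_0 x y : 0 <= rpow x y.
Proof. unfold rpow; destruct Req_EM_T; [lra | left; apply Rpower_pos]. Qed.

Lemma rpow_le_inv x y M : 0 <= x -> 0 < y -> 0 < M -> rpow x (/ y) <= M -> x <= Rpower M y.
Proof.
  intros Hx Hy HM H; pose proof (Rpower_pos M y).
  destruct (Req_EM_T x 0) as [-> | Hn]; [lra |].
  rewrite rpow_pos_eq in H by lra.
  replace x with (Rpower (Rpower x (/ y)) y).
  - apply Rpower_le_base; auto; [apply Rpower_pos | lra].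
  - rewrite Rpower_mult, Rinv_l, Rpower_1; lra.
Qed.

Lemma interpolation u v x p :
  0 < p < 2 -> 0 < v -> x <= u ^ 2 -> x <= v -> x <= rpow (Rabs u) p * Rpower v (1 - p / 2).
Proof.
  intros Hp Hv Hu Hx.
  pose proof (rpow_ge_0 (Rabs u) p); pose proof (Rpower_pos v (1 - p / 2)).
  destruct (Rle_dec x 0) as [Hx0 | Hx0]; [nra |].
  assert (Hu0 : 0 < Rabs u).
  { apply Rabs_pos_lt; intros ->; simpl in Hu; lra. }
  rewrite rpow_pos_eq by auto.
  replace x with (Rpower x (p / 2) * Rpower x (1 - p / 2)).
  2: { rewrite <- Rpower_plus; replace (p / 2 + (1 - p / 2)) with 1 by ring.
       apply Rpower_1; lra. }
  apply Rmult_le_compat; try (left; apply Rpower_pos).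
  - replace (Rpower (Rabs u) p) with (Rpower (u ^ 2) (p / 2)).
    + apply Rpower_le_base; lra.
    + rewrite <- (pow2_abs u), <- (Rpower_pow 2 (Rabs u)), Rpower_mult by auto.
      f_equal; simpl; field.
  - apply Rpower_le_base; lra.
Qed.

Lemma partial_sum_le_Series (a : nat -> R) n m :
  (forall k, 0 <= a k) -> ex_series a -> sum_n_m a n m <= Series a.
Proof.
  intros Ha He.
  apply Rle_trans with (sum_n a m).
  - apply (sum_n_m_incl a n m 0 m); auto; lia.
  - apply (is_lim_seq_incr_compare (sum_n a) (Series a)).
    + apply (Series_correct a He).
    + intros k; rewrite sum_Sn; unfold plus; simpl; pose proof (Ha (S k)); lra.
Qed.

Lemma Series_bounded (a : nat -> R) B :
  (forall k, 0 <= a k) -> (forall n, sum_n a n <= B) -> ex_series a /\ Series a <= B.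
Proof.
  intros Ha HB.
  assert (Hi : forall n, sum_n a n <= sum_n a (S n)).
  { intros k; rewrite sum_Sn; unfold plus; simpl; pose proof (Ha (S k)); lra. }
  destruct (ex_finite_lim_seq_incr (sum_n a) B Hi HB) as [l Hl].
  assert (Hs : is_series a l) by exact Hl.
  split; [now exists l |].
  rewrite (is_series_unique a l Hs).
  exact (is_lim_seq_le _ _ _ _ HB Hl (is_lim_seq_const B)).
Qed.

(** Summation by a potential: once a function [g] is found whose increments dominate the block sums,
    everything telescopes and no series has to be summed in closed form. *)
Lemma sum_blocks (b : nat -> nat) (f g : nat -> R) i l :
  (forall j, (b j <= b (S j))%nat) ->
  (forall j, (i <= j < i + l)%nat -> sum_n_m f (S (b j)) (b (S j)) <= g (S j) - g j) ->
  sum_n_m f (S (b i)) (b (i + l)%nat) <= g (i + l)%nat - g i.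
Proof.
  intros Hb; induction l as [|l IH]; intros H.
  - rewrite Nat.add_0_r, sum_n_m_empty by lia; lra.
  - assert (Hmono : (b i <= b (i + l))%nat).
    { clear -Hb; induction l as [|l IH]; [rewrite Nat.add_0_r; lia |].
      rewrite Nat.add_succ_r; specialize (Hb (i + l)%nat); lia. }
    rewrite Nat.add_succ_r.
    rewrite (sum_n_m_split f _ (b (i + l)%nat) _) by (auto; lia).
    assert (sum_n_m f (S (b i)) (b (i + l)%nat) <= g (i + l)%nat - g i)
      by (apply IH; intros; apply H; lia).
    specialize (H (i + l)%nat ltac:(lia)); lra.
Qed.

(* What both balls share, and all that the risk bound needs. *)
Definition weak_tail (p s A : R) (theta : nat -> R) : Prop :=
  forall K L : nat, (1 <= K)%nat ->
  sum_n_m (fun i => rpow (Rabs (theta i)) p) K L <= A * Rpower (INR K) (- (p * s)).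

(** On [i >= K] the weight [i^(ps)] is at least [K^(ps)], and the weighted sum is at most [M^p]. *)
Lemma Lp_ball_weak_tail p alpha M theta :
  0 < p -> 0 < M -> 0 < sparam p alpha -> Lp_ball p alpha M theta ->
  weak_tail p (sparam p alpha) (Rpower M p) theta.
Proof.
  intros Hp HM Hs [Hex HS] K L HK.
  set (s := sparam p alpha) in *.
  set (a := fun k : nat => Rpower (INR (S k)) (p * s) * rpow (Rabs (theta (S k))) p) in *.
  assert (Ha : forall k, 0 <= a k)
    by (intros k; apply Rmult_le_pos; [left; apply Rpower_pos | apply rpow_ge_0]).
  assert (HS0 : 0 <= Series a).
  { eapply Rle_trans; [| apply (partial_sum_le_Series a 0 0 Ha Hex)].
    now apply sum_n_m_ge_0. }
  apply rpow_le_inv in HS; auto.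
  assert (HK0 : 0 < INR K) by (apply lt_0_INR; lia).
  destruct (le_lt_dec 1 L) as [HL | HL].
  2: { rewrite sum_n_m_empty by lia; apply Rmult_le_pos; left; apply Rpower_pos. }
  apply Rle_trans with (Rpower (INR K) (- (p * s)) * sum_n_m a (K - 1) (L - 1)).
  - rewrite <- sum_n_m_scal.
    (* The series starts at [0] and its term [a k] weighs [theta (S k)], hence the shift by one. *)
    replace K with (S (K - 1)) at 1 by lia; replace L with (S (L - 1)) at 1 by lia.
    rewrite <- sum_n_m_S.
    apply sum_n_m_le_loc; intros k Hk; unfold a.
    rewrite <- Rmult_assoc, Rpower_Ropp.
    rewrite <- (Rmult_1_l (rpow _ _)) at 1.
    apply Rmult_le_compat_r; [apply rpow_ge_0 |].
    pose proof (Rpower_pos (INR K) (p * s)).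
    apply Rmult_le_reg_l with (Rpower (INR K) (p * s)); auto.
    rewrite <- Rmult_assoc, Rinv_r, Rmult_1_l, Rmult_1_r by lra.
    apply Rpower_le_base; auto.
    + apply le_INR; lia.
    + left; now apply Rmult_lt_0_compat.
  - rewrite Rmult_comm; apply Rmult_le_compat_r; [left; apply Rpower_pos |].
    eapply Rle_trans; [apply (partial_sum_le_Series a); auto | auto].
Qed.

Lemma sum_n_m_offset (f : nat -> R) c n m :
  sum_n_m (fun k => f (c + k)%nat) n m = sum_n_m f (c + n) (c + m).
Proof.
  revert n m f; induction c as [|c IH]; intros n m f; [reflexivity |].
  simpl; rewrite <- sum_n_m_S; apply (IH n m (fun k => f (S k))).
Qed.

Lemma INR_pow2 j : INR (2 ^ j) = 2 ^ j.
Proof. rewrite pow_INR; simpl; f_equal; ring. Qed.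

Lemma pow2_ge_1 j : (1 <= 2 ^ j)%nat.
Proof. pose proof (Nat.pow_nonzero 2 j); lia. Qed.

Lemma Rpower_pow2 j x : Rpower (2 ^ j) x = Rpower 2 (INR j * x).
Proof. rewrite <- Rpower_pow, Rpower_mult by lra; reflexivity. Qed.

Lemma Rpower_geom c j : Rpower 2 (- (INR j * c)) = Rpower 2 (- c) ^ j.
Proof.
  rewrite <- Rpower_pow, Rpower_mult by apply Rpower_pos; f_equal; ring.
Qed.

Lemma Rpower_2_neg_lt_1 c : 0 < c -> 0 < Rpower 2 (- c) < 1.
Proof.
  intros Hc; split; [apply Rpower_pos |].
  rewrite <- (Rpower_O 2) by lra; apply Rpower_lt; lra.
Qed.

(** Each level is bounded by the whole series, so [q] disappears and the p-th power sum over level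
    [j] is at most [M^p 2^(-jps)]. Summing the geometric series from the level containing [K] gives
    the tail. *)
Lemma besov_ball_weak_tail p q alpha M theta :
  0 < p -> 0 < q -> 0 < M -> 0 < sparam p alpha -> besov_ball p q alpha M theta ->
  let c := p * sparam p alpha in
  weak_tail p (sparam p alpha) (Rpower M p / (1 - Rpower 2 (- c)) * Rpower 2 c) theta.
Proof.
  intros Hp Hq HM Hs [Hex HS] c K L HK.
  set (s := sparam p alpha) in *.
  set (f := fun i => rpow (Rabs (theta i)) p).
  assert (Hf : forall i, 0 <= f i) by (intros; apply rpow_ge_0).
  set (b := fun j : nat => rpow (Rpower 2 (INR j * s) *
     rpow (sum_n_m (fun k => f (2 ^ j + k)%nat) 0 (2 ^ j - 1)) (/ p)) q) in *.
  change (ex_series b) in Hex; change (rpow (Series b) (/ q) <= M) in HS.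
  assert (Hb : forall k, 0 <= b k) by (intros; apply rpow_ge_0).
  assert (HS0 : 0 <= Series b).
  { eapply Rle_trans; [| apply (partial_sum_le_Series b 0 0 Hb Hex)].
    now apply sum_n_m_ge_0. }
  apply rpow_le_inv in HS; auto.
  assert (Hc : 0 < c) by now apply Rmult_lt_0_compat.
  destruct (Rpower_2_neg_lt_1 c Hc) as [Hr0 Hr1]; set (r := Rpower 2 (- c)) in *.
  set (D := Rpower M p / (1 - r)).
  assert (HD : 0 < D) by (apply Rdiv_lt_0_compat; [apply Rpower_pos | lra]).
  (* Level [j] occupies the indices from [2^j] to [2^(j+1) - 1]; the lower end is written as a
     successor to fit the half-open blocks of [sum_blocks]. *)
  assert (Hblock : forall j, sum_n_m f (S (2 ^ j - 1)) (2 ^ S j - 1) <= Rpower M p * r ^ j).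
  { intros j; pose proof (pow2_ge_1 j).
    replace (S (2 ^ j - 1)) with (2 ^ j + 0)%nat by lia.
    replace (2 ^ S j - 1)%nat with (2 ^ j + (2 ^ j - 1))%nat by (simpl; lia).
    rewrite <- sum_n_m_offset.
    set (T := sum_n_m (fun k => f (2 ^ j + k)%nat) 0 (2 ^ j - 1)).
    assert (HS' : 0 <= T) by (apply sum_n_m_ge_0; auto).
    assert (H1 : b j <= Rpower M q).
    { rewrite <- (sum_n_n b j); eapply Rle_trans; [now apply partial_sum_le_Series | auto]. }
    unfold b in H1; fold T in H1.
    pose proof (Rpower_pos 2 (INR j * s)) as Hg; pose proof (rpow_ge_0 T (/ p)) as Hr.
    assert (H2 : rpow T (/ p) <= M * Rpower 2 (- (INR j * s))).
    { rewrite Rpower_Ropp.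
      apply Rmult_le_reg_l with (Rpower 2 (INR j * s)); auto.
      replace (Rpower 2 (INR j * s) * (M * / Rpower 2 (INR j * s))) with M by (field; lra).
      destruct (Req_EM_T (rpow T (/ p)) 0) as [H3 | H3]; [rewrite H3; lra |].
      rewrite rpow_pos_eq in H1 by (apply Rmult_lt_0_compat; lra).
      apply Rnot_lt_le; intros Hlt.
      apply (Rlt_not_le _ _ (Rlt_Rpower_l _ _ _ Hq (conj HM Hlt))); auto. }
    apply rpow_le_inv in H2; auto.
    2: { apply Rmult_lt_0_compat; auto; apply Rpower_pos. }
    eapply Rle_trans; [apply H2 |].
    rewrite <- Rpower_mult_distr by (auto; apply Rpower_pos).
    right; f_equal; rewrite Rpower_mult; unfold r; rewrite <- Rpower_geom.
    f_equal; unfold c; ring. }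
  set (j := Nat.log2 K).
  destruct (Nat.log2_spec K) as [Hj1 Hj2]; [lia |]; fold j in Hj1, Hj2.
  apply Rle_trans with (D * r ^ j).
  (* Taking [S L] levels surely reaches past [L], since [2^(j + S L) > L]. *)
  - apply Rle_trans with (sum_n_m f (S (2 ^ j - 1)) (2 ^ (j + S L) - 1)).
    + apply sum_n_m_incl; auto.
      * lia.
      * pose proof (Nat.pow_gt_lin_r 2 (j + S L) ltac:(lia)); lia.
    + eapply Rle_trans.
      * apply (sum_blocks (fun j => 2 ^ j - 1)%nat f (fun j => - D * r ^ j) j (S L)).
        -- intros k; simpl; lia.
        -- intros k _; eapply Rle_trans; [apply Hblock |].
           right; unfold D; simpl; field; lra.
      * assert (0 < r ^ (j + S L)) by (apply pow_lt; lra); nra.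
  - rewrite Rmult_assoc; apply Rmult_le_compat_l; [lra |].
    unfold r; rewrite <- Rpower_geom.
    replace (- (INR j * c)) with (c + - (INR (S j) * c)) by (rewrite S_INR; ring).
    rewrite Rpower_plus; apply Rmult_le_compat_l; [left; apply Rpower_pos |].
    (* Only [K < 2^(j+1)] bounds [K] from above, so passing from [2^(-jc)] to [K^(-c)] loses the
       factor [2^c] seen in the constant. *)
    replace (- (INR (S j) * c)) with (INR (S j) * - c) by ring.
    rewrite <- Rpower_pow2; fold c.
    apply Rpower_neg_le_base; [apply lt_0_INR; lia | | lra].
    rewrite <- INR_pow2; apply le_INR; lia.
Qed.

(** Each [|theta_i|^p] is itself at most the tail bound [T], so [theta_i^2] is at most
    [|theta_i|^p T^(2/p - 1)], the exponent being nonnegative because [p < 2]. Summing gives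
    [T^(2/p)]. *)
Lemma weak_tail_sqr_sum p s A theta K L :
  0 < p < 2 -> 0 < A -> weak_tail p s A theta -> (1 <= K)%nat ->
  sum_n_m (fun i => theta i ^ 2) K L <= Rpower A (2 / p) * Rpower (INR K) (- (2 * s)).
Proof.
  intros Hp HA Hw HK.
  assert (HK0 : 0 < INR K) by (apply lt_0_INR; lia).
  set (T := A * Rpower (INR K) (- (p * s))).
  assert (HT : 0 < T) by (apply Rmult_lt_0_compat; [auto | apply Rpower_pos]).
  apply Rle_trans with (T * Rpower T (2 / p - 1)).
  - eapply Rle_trans; [| apply Rmult_le_compat_r;
      [left; apply Rpower_pos | apply (Hw K L HK)]].
    rewrite Rmult_comm, <- sum_n_m_scal.
    apply sum_n_m_le_loc; intros i Hi.
    assert (Hle : rpow (Rabs (theta i)) p <= T).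
    { eapply Rle_trans; [| apply (Hw K L HK)].
      rewrite <- (sum_n_n (fun i => rpow (Rabs (theta i)) p) i).
      apply sum_n_m_incl; try lia; intros; apply rpow_ge_0. }
    destruct (Req_EM_T (theta i) 0) as [H0 | H0].
    { rewrite H0, Rabs_R0, rpow_0; simpl; lra. }
    assert (Ht : 0 < Rabs (theta i)) by now apply Rabs_pos_lt.
    rewrite rpow_pos_eq in * by auto.
    rewrite <- pow2_abs.
    replace (Rabs (theta i) ^ 2)
      with (Rpower (Rpower (Rabs (theta i)) p) (2 / p - 1) * Rpower (Rabs (theta i)) p).
    + apply Rmult_le_compat_r; [left; apply Rpower_pos |].
      apply Rpower_le_base; auto; [apply Rpower_pos |].
      enough (1 <= 2 / p) by lra.
      apply Rmult_le_reg_r with p; [lra |]; unfold Rdiv; rewrite Rmult_assoc, Rinv_l; lra.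
    + rewrite Rpower_mult, <- Rpower_plus, <- Rpower_pow by auto.
      f_equal; simpl; field; lra.
  - right; rewrite <- (Rpower_1 T) at 1 by auto; rewrite <- Rpower_plus.
    replace (1 + (2 / p - 1)) with (2 / p) by ring.
    unfold T; rewrite <- Rpower_mult_distr by (auto; apply Rpower_pos).
    f_equal; rewrite Rpower_mult; f_equal; field; lra.
Qed.

Lemma weak_tail_sqr_sum_all p s A theta N :
  0 < p < 2 -> 0 < A -> weak_tail p s A theta ->
  sum_n_m (fun i => theta i ^ 2) 1 N <= Rpower A (2 / p).
Proof.
  intros Hp HA Hw; eapply Rle_trans; [apply (weak_tail_sqr_sum p s A); auto; lia |].
  simpl INR; unfold Rpower at 2; rewrite ln_1, Rmult_0_r, exp_0; lra.
Qed.

Lemma weak_tail_Qfun p s A theta N :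
  0 < p < 2 -> 0 < A -> weak_tail p s A theta -> (1 <= N)%nat ->
  Rabs (sum_n_m (fun i => theta i ^ 2) 1 N - Qfun theta)
  <= Rpower A (2 / p) * Rpower (INR N) (- (2 * s)).
Proof.
  intros Hp HA Hw HN.
  set (f := fun i => theta i ^ 2); set (B := Rpower A (2 / p) * Rpower (INR N) (- (2 * s))).
  assert (Hf : forall k, 0 <= f k) by (intros; apply pow2_ge_0).
  assert (HB : forall n, sum_n (fun k => f (S k)) n <= sum_n_m f 1 N + B).
  { intros n; unfold sum_n; rewrite sum_n_m_S.
    apply Rle_trans with (sum_n_m f 1 (N + S n)); [apply sum_n_m_incl; auto; lia |].
    rewrite (sum_n_m_split f 1 N) by lia.
    apply Rplus_le_compat_l.
    (* The index [N] is included once more so that the bound is expressed in [N] rather than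
       [N + 1]. *)
    apply Rle_trans with (sum_n_m f N (N + S n)); [apply sum_n_m_incl; auto; lia |].
    apply weak_tail_sqr_sum; auto. }
  destruct (Series_bounded (fun k => f (S k)) _ (fun k => Hf (S k)) HB) as [Hex HS].
  pose proof (partial_sum_le_Series (fun k => f (S k)) 0 (N - 1) (fun k => Hf (S k)) Hex) as Hl.
  rewrite sum_n_m_S in Hl; replace (S (N - 1)) with N in Hl by lia.
  unfold Qfun; change (fun k => theta (S k) ^ 2) with (fun k => f (S k)).
  apply Rabs_le; lra.
Qed.

(** On the block, [log2 (i / m3)] lies in [(j, j + 1]], open on the left and closed on the right
    exactly as the fibres of the ceiling. *)
Lemma tau_block p alpha n j i :
  (2 ^ j * m3 p alpha n < i <= 2 ^ S j * m3 p alpha n)%nat ->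
  tau p alpha n i = 2 * (INR j + 1).
Proof.
  set (m := m3 p alpha n); intros Hi; unfold tau; fold m; f_equal.
  assert (Hm : (0 < m)%nat) by nia.
  assert (Hm0 : 0 < INR m) by (now apply lt_0_INR).
  assert (Hi0 : 0 < INR i) by (apply lt_0_INR; lia).
  assert (H1 : 2 ^ j * INR m < INR i)
    by (rewrite <- INR_pow2, <- mult_INR; apply lt_INR; lia).
  assert (H2 : INR i <= 2 ^ S j * INR m)
    by (rewrite <- INR_pow2, <- mult_INR; apply le_INR; lia).
  assert (Hln2 : 0 < ln 2) by (rewrite <- ln_1; apply ln_increasing; lra).
  set (x := log2 (INR i / INR m)).
  assert (Hx : x * ln 2 = ln (INR i / INR m)) by (unfold x, log2; field; lra).
  assert (Hd : 0 < INR i / INR m) by now apply Rdiv_lt_0_compat.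
  assert (Hx1 : INR j < x).
  { apply Rmult_lt_reg_r with (ln 2); auto.
    rewrite Hx, <- ln_pow by lra.
    apply ln_increasing; [apply pow_lt; lra |].
    apply Rmult_lt_reg_r with (INR m); auto.
    unfold Rdiv; rewrite Rmult_assoc, Rinv_l; lra. }
  assert (Hx2 : x <= INR j + 1).
  { apply Rmult_le_reg_r with (ln 2); auto.
    rewrite Hx, <- S_INR, <- ln_pow by lra.
    apply ln_le; auto.
    apply Rmult_le_reg_r with (INR m); auto.
    unfold Rdiv; rewrite Rmult_assoc, Rinv_l; lra. }
  unfold ceilZ; destruct (base_Int_part (- x)) as [Hb1 Hb2].
  set (z := Int_part (- x)) in *.
  (* The integer part [z] of [- x] lies strictly between [- j - 2] and [- j]. *)
  assert (z = - Z.of_nat (S j))%Z.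
  { rewrite INR_IZR_INZ in Hx1, Hx2.
    assert (IZR z < IZR (- Z.of_nat j)) by (rewrite opp_IZR; lra).
    assert (IZR (- Z.of_nat j - 2) < IZR z) by (rewrite minus_IZR, opp_IZR; lra).
    apply lt_IZR in H, H0; lia. }
  rewrite H, Z.opp_involutive, <- INR_IZR_INZ, S_INR; reflexivity.
Qed.

(** A nonnegative exponent gives [x >= 1], so rounding down leaves at least [1] and loses at most
    half of [x]. *)
Lemma m3_bounds p alpha n :
  (1 <= n)%nat -> 0 <= p / (1 + 2 * p * sparam p alpha) ->
  let x := Rpower (INR n) (p / (1 + 2 * p * sparam p alpha)) in
  (1 <= m3 p alpha n)%nat /\ x / 2 <= INR (m3 p alpha n) <= x.
Proof.
  intros Hn Hr x.
  assert (Hx : 1 <= x).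
  { apply Rle_trans with (Rpower (INR n) 0).
    - rewrite Rpower_O; [lra | apply lt_0_INR; lia].
    - apply Rle_Rpower; auto; apply (le_INR 1); auto. }
  unfold m3, floorZ; fold x; destruct (base_Int_part x) as [H1 H2].
  set (z := Int_part x) in *.
  assert (Hz : (0 < z)%Z) by (apply lt_IZR; lra).
  assert (HI : INR (Z.to_nat z) = IZR z) by (rewrite INR_IZR_INZ, Z2Nat.id; auto; lia).
  assert (1 <= IZR z) by (apply IZR_le; lia).
  rewrite HI; split; [lia | lra].
Qed.

(** * The risk bound *)

Lemma tau_pos p alpha n J i :
  (S (m3 p alpha n) <= i <= 2 ^ J * m3 p alpha n)%nat -> 0 < tau p alpha n i.
Proof.
  set (m := m3 p alpha n); induction J as [|J IH]; intros Hi.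
  - simpl in Hi; lia.
  - destruct (le_lt_dec i (2 ^ J * m)) as [H | H]; [apply IH; lia |].
    rewrite (tau_block p alpha n J i) by (fold m; lia).
    pose proof (pos_INR J); lra.
Qed.

(** The factor from one dyadic block to the next: the block length doubles, while [tau] grows by [2]
    and so multiplies [exp (- (2/5) tau)] by [exp (- 4/5)]. *)
Definition noise_ratio : R := 2 * exp (- (4 / 5)).

Lemma noise_ratio_bounds : 0 < noise_ratio < 1.
Proof.
  unfold noise_ratio; pose proof (exp_pos (- (4 / 5))).
  (* The direct bound [1 + 4/5 <= exp (4/5)] falls short of [2]; splitting the exponent into four
     parts gives [(6/5)^4 = 2.0736]. *)
  assert (H5 : 1 + / 5 <= exp (/ 5)) by apply exp_ineq1_le.
  assert (H4 : exp (4 / 5) = exp (/ 5) ^ 4).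
  { replace (4 / 5) with (/ 5 + / 5 + / 5 + / 5) by field; rewrite !exp_plus; ring. }
  assert (2 < exp (4 / 5)).
  { rewrite H4; apply Rlt_le_trans with ((1 + / 5) ^ 4); [simpl; lra |].
    apply pow_incr; lra. }
  assert (exp (- (4 / 5)) * exp (4 / 5) = 1)
    by (rewrite <- exp_plus, Rplus_opp_l; apply exp_0).
  split; nra.
Qed.

Lemma block_incr m j : (2 ^ j * m <= 2 ^ S j * m)%nat.
Proof. simpl; nia. Qed.

Lemma sum_dyadic_blocks (f g : nat -> R) m J :
  (forall j, sum_n_m f (S (2 ^ j * m)) (2 ^ S j * m) <= g (S j) - g j) ->
  sum_n_m f (S m) (2 ^ J * m) <= g J - g 0%nat.
Proof.
  intros H.
  pose proof (sum_blocks (fun j => 2 ^ j * m)%nat f g 0 J (block_incr m) (fun j _ => H j)) as Hs.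
  simpl in Hs; now rewrite Nat.add_0_r in Hs.
Qed.

Lemma noise_sum_le p alpha n J :
  let m := m3 p alpha n in
  sum_n_m (fun i => exp (- (2 / 5) * tau p alpha n i)) (S m) (2 ^ J * m)
  <= noise_ratio / (2 * (1 - noise_ratio)) * INR m.
Proof.
  intros m; pose proof noise_ratio_bounds as Hr; set (r := noise_ratio) in *.
  set (D := r / (2 * (1 - r)) * INR m).
  assert (HD : 0 <= D).
  { apply Rmult_le_pos; [apply Rdiv_le_0_compat; lra | apply pos_INR]. }
  eapply Rle_trans.
  (* Block [j] has [2^j m] terms equal to [(r/2)^(j+1)], in total [m r^(j+1) / 2]; [D] is chosen so
     that [D (1 - r) r^j] equals this. *)
  - apply (sum_dyadic_blocks _ (fun j => - D * r ^ j)).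
    intros j.
    rewrite (sum_n_m_ext_loc _ (fun _ => (r / 2) ^ S j)).
    + rewrite sum_n_m_cst.
      replace (S (2 ^ S j * m) - S (2 ^ j * m))%nat with (2 ^ j * m)%nat by (simpl; nia).
      rewrite mult_INR, INR_pow2; right; unfold D; simpl.
      unfold Rdiv; rewrite Rpow_mult_distr, pow_inv.
      field; split; [lra |]; apply pow_nonzero; lra.
    + intros i Hi; rewrite (tau_block p alpha n j i) by (fold m; lia).
      unfold r, noise_ratio; replace (2 * exp (- (4 / 5)) / 2) with (exp (- (4 / 5))) by field.
      rewrite <- Rpower_pow by apply exp_pos.
      unfold Rpower; rewrite ln_exp, S_INR; f_equal; field.
  - simpl; pose proof (pow_le r J); nra.
Qed.

Lemma threshold_bias_interp p n t th :
  0 < p < 2 -> 0 < n -> 0 < t ->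
  Rabs (threshold_bias t (sqrt n * th) / n)
  <= 384 * (rpow (Rabs th) p * Rpower (t / n) (1 - p / 2)).
Proof.
  intros Hp Hn Ht.
  unfold Rdiv at 1; rewrite Rabs_mult, (Rabs_pos_eq (/ n))
    by (left; now apply Rinv_0_lt_compat).
  set (b := Rabs _).
  assert (H1 : b <= t) by (apply threshold_bias_le_threshold; lra).
  assert (H2 : b <= 384 * (n * th ^ 2)).
  { eapply Rle_trans; [apply threshold_bias_le_sqr; lra |].
    rewrite Rpow_mult_distr, pow2_sqrt; lra. }
  assert (Hi : 0 < / n) by now apply Rinv_0_lt_compat.
  (* Dividing by [384] first puts the quantity below both [th^2] and [t/n] with constant one, as the
     interpolation demands. *)
  replace (b * / n) with (384 * (b / (384 * n))) by (field; lra).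
  apply Rmult_le_compat_l; [lra |].
  assert (0 <= b) by apply Rabs_pos.
  apply interpolation; auto.
  - now apply Rdiv_lt_0_compat.
  - apply Rmult_le_reg_r with (384 * n); [lra |].
    unfold Rdiv; rewrite Rmult_assoc, Rinv_l; lra.
  - apply Rmult_le_reg_r with (384 * n); [lra |].
    replace (b / (384 * n) * (384 * n)) with b by (field; lra).
    replace (t / n * (384 * n)) with (384 * t) by (field; lra).
    lra.
Qed.

Lemma bias_sum_le p alpha A theta n J :
  let s := sparam p alpha in
  let m := m3 p alpha n in
  let rho := Rpower 2 (- (p * s)) in
  0 < p < 2 -> 0 < s -> 0 < A -> weak_tail p s A theta -> (1 <= n)%nat -> (1 <= m)%nat ->
  sum_n_m (fun i => Rabs (threshold_bias (tau p alpha n i) (sqrt (INR n) * theta i) / INR n))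
    (S m) (2 ^ J * m)
  <= 768 * A / (1 - rho) ^ 2 * (Rpower (INR n) (- (1 - p / 2)) * Rpower (INR m) (- (p * s))).
Proof.
  intros s m rho Hp Hs HA Hw Hn Hm.
  assert (Hn0 : 0 < INR n) by (apply lt_0_INR; lia).
  assert (Hm0 : 0 < INR m) by (apply lt_0_INR; lia).
  assert (Hc : 0 < p * s) by (apply Rmult_lt_0_compat; lra).
  destruct (Rpower_2_neg_lt_1 (p * s) Hc) as [Hr0 Hr1]; fold rho in Hr0, Hr1.
  set (W := Rpower (INR n) (- (1 - p / 2))); set (V := Rpower (INR m) (- (p * s))).
  assert (HW : 0 < W) by apply Rpower_pos; assert (HV : 0 < V) by apply Rpower_pos.
  set (D := 768 * A / (1 - rho) ^ 2 * (W * V)).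
  assert (HD : 0 < D).
  { apply Rmult_lt_0_compat; [| now apply Rmult_lt_0_compat].
    apply Rdiv_lt_0_compat; [lra | apply pow_lt; lra]. }
  eapply Rle_trans.
  (* A potential for the series of [(j + 1) rho^j]: the function [rho^j (1 + j (1 - rho))] drops by
     [(1 - rho)^2 (j + 1) rho^j] at each step, whence the square in the constant. The [768] is [384]
     times the [2] in [tau]. *)
  - apply (sum_dyadic_blocks _ (fun j => - D * (rho ^ j * (1 + INR j * (1 - rho))))).
    intros j.
    apply Rle_trans with (sum_n_m (fun i => 768 * (INR j + 1) * W * rpow (Rabs (theta i)) p)
      (S (2 ^ j * m)) (2 ^ S j * m)).
    + apply sum_n_m_le_loc; intros i Hi.
      rewrite (tau_block p alpha n j i) by (fold m; lia).
      pose proof (pos_INR j).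
      eapply Rle_trans; [apply (threshold_bias_interp p); auto; lra |].
      replace (768 * (INR j + 1) * W * rpow (Rabs (theta i)) p)
        with (384 * (rpow (Rabs (theta i)) p * (2 * (INR j + 1) * W))) by ring.
      apply Rmult_le_compat_l; [lra |].
      apply Rmult_le_compat_l; [apply rpow_ge_0 |].
      unfold Rdiv at 1; rewrite <- Rpower_mult_distr
        by (try apply Rinv_0_lt_compat; lra).
      unfold W.
      replace (Rpower (/ INR n) (1 - p / 2)) with (Rpower (INR n) (- (1 - p / 2))).
      2: { unfold Rpower; rewrite ln_Rinv by auto; f_equal; ring. }
      apply Rmult_le_compat_r; [left; apply Rpower_pos |].
      (* The power [1 - p/2] of the threshold is relaxed to the first power: growth linear in [j] is
         still harmless against [rho^j]. *)
      rewrite <- (Rpower_1 (2 * (INR j + 1))) at 2 by lra.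
      apply Rle_Rpower; lra.
    + rewrite sum_n_m_scal.
      apply Rle_trans with (768 * (INR j + 1) * W * (A * (rho ^ j * V))).
      * pose proof (pos_INR j).
        apply Rmult_le_compat_l; [apply Rmult_le_pos; lra |].
        eapply Rle_trans; [apply Hw; lia |].
        apply Rmult_le_compat_l; [lra |].
        apply Rle_trans with (Rpower (INR (2 ^ j * m)) (- (p * s))).
        -- apply Rpower_neg_le_base; [| apply le_INR; lia | lra].
           rewrite mult_INR, INR_pow2; apply Rmult_lt_0_compat; auto; apply pow_lt; lra.
        -- rewrite mult_INR, INR_pow2, <- Rpower_mult_distr by (auto; apply pow_lt; lra).
           right; unfold V; f_equal.
           rewrite Rpower_pow2; unfold rho; rewrite <- Rpower_geom; f_equal; ring.
      * right; unfold D; rewrite S_INR; simpl; field; lra.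
  - assert (0 <= rho ^ J * (1 + INR J * (1 - rho))).
    { apply Rmult_le_pos; [apply pow_le; lra |].
      pose proof (pos_INR J); nra. }
    simpl (INR 0); simpl (rho ^ 0); nra.
Qed.

Lemma ln_ge_1 n : (3 <= n)%nat -> 1 <= ln (INR n).
Proof.
  intros Hn; rewrite <- (ln_exp 1).
  apply ln_le; [apply exp_pos |].
  eapply Rle_trans; [apply exp_le_3 |]; apply (le_INR 3) in Hn; simpl in Hn; lra.
Qed.

Lemma Jstar_lower p alpha n J :
  (3 <= n)%nat -> is_Jstar p alpha n J ->
  / 2 * Rpower (INR n) (/ (4 * sparam p alpha)) <= INR (2 ^ J * m3 p alpha n).
Proof.
  intros Hn [_ Hmax].
  set (X := Rpower (INR n) (/ (4 * sparam p alpha)) * ln (INR n)) in *.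
  assert (HX : X < INR (2 ^ S J * m3 p alpha n)).
  { apply Rnot_le_lt; intros Hle; apply Hmax in Hle; lia. }
  rewrite mult_INR, INR_pow2 in HX |- *; simpl in HX.
  pose proof (ln_ge_1 n Hn); pose proof (Rpower_pos (INR n) (/ (4 * sparam p alpha))).
  unfold X in HX; nra.
Qed.

Lemma weak_tail_risk p alpha A :
  0 < p < 2 -> alpha <= / (2 * p) -> 0 < sparam p alpha -> 0 < A ->
  exists C, 0 < C /\ forall n J theta, (3 <= n)%nat -> is_Jstar p alpha n J ->
    weak_tail p (sparam p alpha) A theta ->
    risk3 p alpha n J theta
    <= C * Rpower (INR n) (- (2 - p / (1 + 2 * p * sparam p alpha))).
Proof.
  intros Hp Ha Hs HA; set (s := sparam p alpha) in *.
  set (r := p / (1 + 2 * p * s)).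
  assert (Hps : 0 < p * s) by (apply Rmult_lt_0_compat; lra).
  assert (Hr : r * (1 + 2 * p * s) = p) by (unfold r; field; lra).
  (* Here [1 + 2ps = 2 p alpha + p - 1], which is at most [p] because [p alpha <= 1/2]. *)
  assert (Hr1 : 1 <= r).
  { assert (p * alpha <= / 2).
    { replace (/ 2) with (p * / (2 * p)) by (field; lra); apply Rmult_le_compat_l; lra. }
    assert (p * s = p * alpha + p / 2 - 1) by (unfold s, sparam; field; lra).
    nra. }
  set (B := Rpower A (2 / p)).
  (* The powers of [1/2] pay for the rounding in [m3] (in [K1]) and for the last dyadic step before
     the bound on [2^J m3] (in [K2]). *)
  set (K1 := 768 * A / (1 - Rpower 2 (- (p * s))) ^ 2 * Rpower (/ 2) (- (p * s))).
  set (K2 := B * Rpower (/ 2) (- (2 * s))).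
  set (c := noise_ratio / (2 * (1 - noise_ratio))).
  assert (HB : 0 < B) by apply Rpower_pos.
  pose proof noise_ratio_bounds as Hnr.
  assert (Hc : 0 < c) by (apply Rdiv_lt_0_compat; lra).
  assert (HK1 : 0 < K1).
  { destruct (Rpower_2_neg_lt_1 (p * s) Hps).
    apply Rmult_lt_0_compat; [| apply Rpower_pos].
    apply Rdiv_lt_0_compat; [lra | apply pow_lt; lra]. }
  assert (HK2 : 0 < K2) by (apply Rmult_lt_0_compat; auto; apply Rpower_pos).
  exists ((K1 + K2) ^ 2 + (160 * B + 152 + 150 * c)).
  split; [assert (0 < (K1 + K2) ^ 2) by (apply pow_lt; lra); lra |].
  intros n J theta Hn HJ Hw.
  set (m := m3 p alpha n); set (N := (2 ^ J * m)%nat).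
  assert (Hr0 : 0 <= r) by lra.
  destruct (m3_bounds p alpha n ltac:(lia) Hr0) as [Hm [Hm1 Hm2]].
  fold s r m in Hm, Hm1, Hm2.
  assert (HN : (1 <= N)%nat) by (unfold N; pose proof (pow2_ge_1 J); nia).
  assert (Hn1 : 1 <= INR n) by (apply (le_INR 1); lia).
  assert (HJN := Jstar_lower p alpha n J Hn HJ); fold s m N in HJN.
  eapply Rle_trans.
  { apply risk3_le; [lia |].
    intros i Hi; left; now apply (tau_pos p alpha n J). }
  fold m N r.
  set (w := Rpower (INR n) (- (1 - r / 2))).
  assert (Hw0 : 0 < w) by apply Rpower_pos.
  assert (Hrate : Rpower (INR n) (- (2 - r)) = w ^ 2)
    by (unfold w; rewrite Rpower_sqr; f_equal; field).
  assert (Hb1 : Rabs (sum_n_m (fun i => threshold_bias (tau p alpha n i)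
      (sqrt (INR n) * theta i) / INR n) (S m) N) <= K1 * w).
  { eapply Rle_trans; [apply sum_n_m_Rabs |].
    eapply Rle_trans; [apply (bias_sum_le p alpha A); auto; lia |].
    fold s m; unfold K1; rewrite Rmult_assoc.
    apply Rmult_le_compat_l.
    { destruct (Rpower_2_neg_lt_1 (p * s) Hps).
      left; apply Rdiv_lt_0_compat; [lra | apply pow_lt; lra]. }
    apply Rle_trans with (Rpower (INR n) (- (1 - p / 2)) *
      Rpower (Rpower (INR n) r / 2) (- (p * s))).
    - apply Rmult_le_compat_l; [left; apply Rpower_pos |].
      apply Rpower_neg_le_base; auto; [| lra].
      apply Rdiv_lt_0_compat; [apply Rpower_pos | lra].
    - unfold Rdiv at 2; rewrite <- Rpower_mult_distr by (try apply Rpower_pos; lra).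
      rewrite Rpower_mult, <- Rmult_assoc, <- Rpower_plus, Rmult_comm.
      (* The exponents match because [r (1 + 2ps) = p], that is [p/2 - r p s = r/2]: this equation
         is what fixes the size of [m3]. *)
      right; unfold w; do 2 f_equal; nra. }
  assert (Hb2 : Rabs (sum_n_m (fun i => theta i ^ 2) 1 N - Qfun theta) <= K2 * w).
  { eapply Rle_trans; [apply (weak_tail_Qfun p s A); auto |].
    fold B; unfold K2; rewrite Rmult_assoc; apply Rmult_le_compat_l; [lra |].
    apply Rle_trans with (Rpower (/ 2 * Rpower (INR n) (/ (4 * s))) (- (2 * s))).
    - apply Rpower_neg_le_base; auto; [| lra].
      apply Rmult_lt_0_compat; [lra | apply Rpower_pos].
    - rewrite <- Rpower_mult_distr by (try apply Rpower_pos; lra).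
      apply Rmult_le_compat_l; [left; apply Rpower_pos |].
      (* The omitted energy is of order [n^(-1/2)], and [1/2 >= 1 - r/2] since [r >= 1]. *)
      rewrite Rpower_mult; replace (/ (4 * s) * - (2 * s)) with (- / 2) by (field; lra).
      apply Rle_Rpower; lra. }
  assert (Hinv : / INR n <= w ^ 2).
  { rewrite <- Hrate, <- (Rpower_1 (INR n)) at 1 by lra.
    rewrite <- Rpower_Ropp; apply Rle_Rpower; lra. }
  assert (Hm3 : / INR n ^ 2 * INR m <= w ^ 2).
  { rewrite <- Hrate.
    replace (Rpower (INR n) (- (2 - r))) with (/ INR n ^ 2 * Rpower (INR n) r).
    - apply Rmult_le_compat_l; auto; left; apply Rinv_0_lt_compat, pow_lt; lra.
    - rewrite <- (Rpower_pow 2) by lra; rewrite <- Rpower_Ropp, <- Rpower_plus.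
      f_equal; simpl; ring. }
  assert (HB1 : sum_n_m (fun i => theta i ^ 2) 1 N <= B)
    by (apply (weak_tail_sqr_sum_all p s); auto).
  assert (Hns : sum_n_m (fun i => exp (- (2 / 5) * tau p alpha n i)) (S m) N <= c * INR m)
    by apply noise_sum_le.
  rewrite Hrate, Rmult_plus_distr_r.
  assert (Hi0 : 0 < / INR n) by (apply Rinv_0_lt_compat; lra).
  assert (Hi2 : 0 < / INR n ^ 2) by (apply Rinv_0_lt_compat, pow_lt; lra).
  apply Rplus_le_compat.
  - rewrite <- Rpow_mult_distr, <- pow2_abs; apply pow_incr; split; [apply Rabs_pos |].
    eapply Rle_trans; [apply Rabs_triang | lra].
  - unfold Rdiv; rewrite !Rmult_assoc.
    assert (/ INR n * sum_n_m (fun i => theta i ^ 2) 1 N <= w ^ 2 * B).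
    { apply Rmult_le_compat; auto; [lra |].
      apply sum_n_m_ge_0; intros; apply pow2_ge_0. }
    assert (/ INR n ^ 2 * sum_n_m (fun i => exp (- (2 / 5) * tau p alpha n i)) (S m) N
      <= c * w ^ 2).
    { apply Rle_trans with (/ INR n ^ 2 * (c * INR m)); [apply Rmult_le_compat_l; lra |].
      replace (/ INR n ^ 2 * (c * INR m)) with (c * (/ INR n ^ 2 * INR m)) by ring.
      apply Rmult_le_compat_l; lra. }
    lra.
Qed.

Theorem theorem3 (p q M alpha : R)
  (hp0 : 0 < p) (hp2 : p < 2) (hq : 0 < q) (hM : 0 < M)
  (ha0 : 0 < alpha) (ha : alpha <= / (2 * p)) (hs : 0 < alpha + / 2 - / p) :
  exists C : R, 0 < C /\
    forall eps : R, 0 < eps ->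
    exists n0 : nat, forall n : nat, (n0 <= n)%nat ->
    forall J : nat, is_Jstar p alpha n J ->
      (forall theta : nat -> R, besov_ball p q alpha M theta ->
         risk3 p alpha n J theta
           <= C * Rpower (INR n) (- (2 - p / (1 + 2 * p * sparam p alpha))) * (1 + eps)) /\
      (forall theta : nat -> R, Lp_ball p alpha M theta ->
         risk3 p alpha n J theta
           <= C * Rpower (INR n) (- (2 - p / (1 + 2 * p * sparam p alpha))) * (1 + eps)).
Proof.
  assert (Hs : 0 < sparam p alpha) by exact hs.
  set (c := p * sparam p alpha).
  assert (Hc : 0 < c) by now apply Rmult_lt_0_compat.
  set (A1 := Rpower M p / (1 - Rpower 2 (- c)) * Rpower 2 c).
  assert (HA1 : 0 < A1).
  { destruct (Rpower_2_neg_lt_1 c Hc).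
    apply Rmult_lt_0_compat; [apply Rdiv_lt_0_compat |]; try apply Rpower_pos; lra. }
  destruct (weak_tail_risk p alpha A1) as [C1 [HC1 H1]]; auto.
  destruct (weak_tail_risk p alpha (Rpower M p)) as [C2 [HC2 H2]]; auto; [apply Rpower_pos |].
  exists (C1 + C2); split; [lra |].
  (* The estimate is non-asymptotic from [n = 3] on, where [ln n >= 1], so the starting index can be
     chosen uniformly in [eps]. *)
  intros eps He; exists 3%nat; intros n Hn J HJ.
  set (R0 := Rpower (INR n) (- (2 - p / (1 + 2 * p * sparam p alpha)))) in *.
  assert (HR : 0 < R0) by apply Rpower_pos.
  assert (Hfin : forall x C, 0 < C <= C1 + C2 -> x <= C * R0 -> x <= (C1 + C2) * R0 * (1 + eps)).
  { intros x C HC Hx.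
    assert (C * R0 <= (C1 + C2) * R0) by (apply Rmult_le_compat_r; lra).
    assert (0 < (C1 + C2) * R0 * eps) by (repeat apply Rmult_lt_0_compat; lra).
    lra. }
  split; intros theta Hth.
  - apply (Hfin _ C1); [lra |].
    apply H1; auto; now apply (besov_ball_weak_tail p q).
  - apply (Hfin _ C2); [lra |].
    apply H2; auto; now apply Lp_ball_weak_tail.
Qed.
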